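(* Let $\mathcal{P}$ be a hereditary random-free graph property. Then for every pure graphon $(J,W)$ in the closure $\overline{\mathcal{P}}$, the metric space $(J,r_W)$ is compact and has finite (upper) packing dimension.
   Context: A graphon is a pair $(J,W)$ with $J$ a standard probability space and $W:J\times J\to[0,1]$ symmetric measurable; $r_W(x,y)=\int_J|W(x,z)-W(y,z)|\,dz$. It is pure if $r_W$ is a metric on $J$, $(J,r_W)$ is complete and separable, and the probability measure has full support. For a finite simple graph $F=(V,E)$, $t(F,W)=\int_{J^V}\prod_{uv\in E}W(x_u,x_v)\,dx$. A finite graph $G$ is viewed as the graphon on $V(G)$ with uniform probability measure and $W_G(x,y)=1$ if $xy\in E(G)$, $0$ otherwise. A sequence of graphs $G_n$ with $|V(G_n)|\to\infty$ converges to a graphon $W$ if $t(F,W_{G_n})\to t(F,W)$ for every finite graph $F$. A graph property is a class of finite graphs closed under isomorphism; it is hereditary if it is closed under taking induced subgraphs. The closure $\overline{\mathcal{P}}$ is the class of graphons arising as limits of convergent graph sequences from $\mathcal{P}$. $\mathcal{P}$ is random-free if every $W\in\overline{\mathcal{P}}$ is $\{0,1\}$-valued almost everywhere. The packing dimension of a metric space is $\limsup_{\varepsilon\to0}\log N(\varepsilon)/\log(1/\varepsilon)$, with $N(\varepsilon)$ the maximum number of points mutually at distance at least $\varepsilon$. *)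

(* Defs.v *)
From HB Require Import structures.
From mathcomp Require Import all_boot all_order all_algebra finmap.
From mathcomp Require Import all_classical all_reals all_analysis.

Set Implicit Arguments.
Unset Strict Implicit.
Unset Printing Implicit Defensive.

Import Order.TTheory GRing.Theory Num.Theory.
Import numFieldTopology.Exports numFieldNormedType.Exports.

Local Open Scope classical_set_scope.
Local Open Scope ring_scope.

Record is_metric (R : realType) (T : Type) (r : T -> T -> R) : Prop :=
  IsMetric {
    is_metric_xx : forall x, r x x = 0;
    is_metric_eq : forall x y, r x y = 0 -> x = y;
    is_metric_sym : forall x y, r x y = r y x;
    is_metric_triangle : forall y x z, r x z <= r x y + r y z }.

(* [T] may already carry a topology; the alias carries only that of [r]. *)
Definition metric_space (R : realType) (T : choiceType) (r : T -> T -> R)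
  (hr : is_metric r) : Type := T.

HB.instance Definition _ (R : realType) (T : choiceType) (r : T -> T -> R)
  (hr : is_metric r) := Choice.on (metric_space hr).

HB.instance Definition _ (R : realType) (T : choiceType) (r : T -> T -> R)
  (hr : is_metric r) :=
  isMetric.Build R (metric_space hr) (is_metric_xx hr) (is_metric_eq hr)
    (is_metric_sym hr) (is_metric_triangle hr).

Definition complete_space (M : uniformType) : Prop :=
  forall F : set_system M, ProperFilter F -> cauchy F -> exists x : M, F --> x.

Definition separable_space (M : topologicalType) : Prop :=
  exists2 D : set M, countable D & dense D.

Section packing.
Context {R : realType} (M : metricType R).

(* The supremum is [+oo] when arbitrarily large separated families exist. *)
Definition packing_number (e : R) : \bar R :=
  ereal_sup [set (size s)%:R%:E |
    s in [set s : seq M | pairwise (fun x y => e <= mdist x y) s]].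

Definition packing_dim : \bar R :=
  limf_esup (fun e : R => lne (packing_number e) / (ln e^-1)%:E)%E 0^'+.

End packing.

(* A measurable space whose sigma-algebra is the Borel sigma-algebra of a
   Polish topology; with a probability measure, a standard probability space. *)
Definition standard_borel (R : realType) (d : measure_display)
    (J : measurableType d) : Prop :=
  exists (r : J -> J -> R) (hr : is_metric r),
    [/\ complete_space (metric_space hr),
        separable_space (metric_space hr) &
        (measurable : set (set J)) =
          <<s [set A : set J | @open (metric_space hr) A] >>].

(* Vertex sets are nonempty, so that [uniform_prob] below is meaningful. *)
Record sgraph := SGraph {
  vertex :> finType;
  edge : rel vertex;
  edge_sym : symmetric edge;
  edge_irrefl : irreflexive edge;
  vertex_gt0 : (0 < #|vertex|)%N }.

Definition graph_iso (G H : sgraph) : Prop :=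
  exists2 f : G -> H, bijective f & forall x y, edge (f x) (f y) = edge x y.

Section induced.
Variables (G : sgraph) (S : {set G}) (x0 : G) (Sx0 : x0 \in S).

Let iedge : rel {x | x \in S} := fun x y => edge (val x) (val y).

Let iedge_sym : symmetric iedge.
Proof. by move=> x y; exact: edge_sym. Qed.

Let iedge_irrefl : irreflexive iedge.
Proof. by move=> x; exact: edge_irrefl. Qed.

Let ivertex_gt0 : (0 < #|{: {x | x \in S}}|)%N.
Proof. by apply/card_gt0P; exists (exist _ x0 Sx0). Qed.

Definition induced_graph : sgraph := SGraph iedge_sym iedge_irrefl ivertex_gt0.

End induced.

Definition graph_property (P : sgraph -> Prop) : Prop :=
  forall G H : sgraph, graph_iso G H -> P G -> P H.

Definition hereditary (P : sgraph -> Prop) : Prop :=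
  forall (G : sgraph) (S : {set G}) (x0 : G) (Sx0 : x0 \in S),
    P G -> P (induced_graph Sx0).

Section tuple_measure.
Context {R : realType} {d : measure_display} {T : measurableType d}.

Definition cons_pair (n : nat) (p : T * n.-tuple T) : n.+1.-tuple T :=
  [the n.+1.-tuple T of p.1 :: p.2].

Lemma measurable_cons_pair n : measurable_fun setT (@cons_pair n).
Proof.
apply: (@measurable_cons _ _ _ T fst n snd).
- exact: measurable_fst.
- exact: measurable_snd.
Qed.

Definition cons_measure (n : nat) (mu : probability T R)
    (nu : probability (n.-tuple T) R) : set (n.+1.-tuple T) -> \bar R :=
  pushforward (mu \x nu)%E (@cons_pair n).

Section instances.
Variables (n : nat) (mu : probability T R) (nu : probability (n.-tuple T) R).

HB.instance Definition _ := Measure.copy (cons_measure mu nu)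
  (measure_function_pushforward__canonical__measure_function_Measure
    (mu \x nu)%E (@measurable_cons_pair n)).

Let cons_measureT : cons_measure mu nu setT = 1%E.
Proof.
by rewrite /cons_measure /pushforward preimage_setT; exact: probability_setT.
Qed.

HB.instance Definition _ :=
  Measure_isProbability.Build _ _ _ (cons_measure mu nu) cons_measureT.

End instances.

Fixpoint tuple_measure (mu : probability T R) (n : nat) :
    probability (n.-tuple T) R :=
  match n with
  | 0%N => \d_([tuple of [::]] : 0.-tuple T)
  | n'.+1 => cons_measure mu (tuple_measure mu n')
  end.

End tuple_measure.

Section graphon.
Context {R : realType} {d : measure_display} {J : measurableType d}.
Variables (mu : probability J R) (W : J * J -> R).

Record is_graphon : Prop := IsGraphon {
  graphon_standard : standard_borel R J;
  graphon_sym : forall x y, W (x, y) = W (y, x);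
  graphon_measurable : measurable_fun setT W;
  graphon_ge0 : forall p, 0 <= W p;
  graphon_le1 : forall p, W p <= 1 }.

Definition nbhd_dist (x y : J) : R := \int[mu]_z `|W (x, z) - W (y, z)|.

Record is_pure : Prop := IsPure {
  pure_metric : is_metric nbhd_dist;
  pure_complete : complete_space (metric_space pure_metric);
  pure_separable : separable_space (metric_space pure_metric);
  pure_full_support : forall U : set (metric_space pure_metric),
    open U -> U !=set0 -> (0 < mu U)%E }.

(* Coordinates are indexed by the vertices through [enum_rank]; comparing the
   ranks makes every unordered edge contribute exactly one factor. *)
Definition hom_density (F : sgraph) : R :=
  \int[tuple_measure mu #|F|]_x
    \prod_(u : F) \prod_(v : F | edge u v && (enum_rank u < enum_rank v)%N)
      W (tnth x (enum_rank u), tnth x (enum_rank v)).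

End graphon.

Definition vertex_space (G : sgraph) : Type := G.

HB.instance Definition _ (G : sgraph) := Finite.on (vertex_space G).

HB.instance Definition _ (G : sgraph) :=
  isPointed.Build (vertex_space G) (enum_val (Ordinal (vertex_gt0 G))).

HB.instance Definition _ (G : sgraph) :=
  @isMeasurable.Build default_measure_display (vertex_space G)
    discrete_measurable discrete_measurable0
    discrete_measurableC discrete_measurableU.

(* The Dirac measure is the fallback of [mnormalize] for null or infinite mass,
   which does not occur here: see [uniform_probE]. *)
Definition uniform_prob (R : realType) (G : sgraph) :
    probability (vertex_space G) R :=
  mnormalize (@counting (vertex_space G) R)
    (\d_(point : vertex_space G)).

Lemma uniform_probE (R : realType) (G : sgraph) (A : {set G}) :
  uniform_prob R G [set` A] = (#|A|%:R / #|G|%:R)%:E.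
Proof.
have cE (B : {set G}) :
    counting ([set` B] : set (vertex_space G)) = #|B|%:R%:E :> \bar R.
  have fB : finite_set ([set` B] : set (vertex_space G)) by exact: finite_finset.
  rewrite /counting asboolT//; congr (_%:R%:E).
  have -> : fset_set ([set` B] : set (vertex_space G)) =
      seq_fset tt (enum B : seq (vertex_space G)).
    apply/fsetP => x; rewrite in_fset_set// seq_fsetE.
    rewrite [RHS](@mem_enum G).
    by apply/idP/idP => [/set_mem|xB]//; exact/mem_set.
  by rewrite size_seq_fset undup_id ?(@enum_uniq G)//; exact/esym/(@cardE G).
have cT : counting [set: vertex_space G] = #|G|%:R%:E :> \bar R.
  rewrite -cardsT -cE; congr counting.
  by apply/seteqP; split => x //= _; rewrite inE.
rewrite /uniform_prob /= /mnormalize /= cT /= eqe pnatr_eq0 eqn0Ngt vertex_gt0 /=.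
by rewrite cE.
Qed.

Definition graph_graphon (R : realType) (G : sgraph)
    (p : vertex_space G * vertex_space G) : R :=
  (@edge G p.1 p.2)%:R.

Section closure.
Variable R : realType.

Definition converges_to (G : nat -> sgraph) (d : measure_display)
    (J : measurableType d) (mu : probability J R) (W : J * J -> R) : Prop :=
  #|G n| @[n --> \oo] --> \oo /\
  forall F : sgraph,
    hom_density (uniform_prob R (G n)) (@graph_graphon R (G n)) F
      @[n --> \oo] --> hom_density mu W F.

Definition in_closure (P : sgraph -> Prop) (d : measure_display)
    (J : measurableType d) (mu : probability J R) (W : J * J -> R) : Prop :=
  is_graphon W /\
  exists2 G : nat -> sgraph, (forall n, P (G n)) & converges_to G mu W.

Definition random_free (P : sgraph -> Prop) : Prop :=
  forall (d : measure_display) (J : measurableType d) (mu : probability J R)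
      (W : J * J -> R),
    in_closure P mu W -> {ae (mu \x mu)%E, forall p, W p = 0 \/ W p = 1}.

End closure.

(* Main.v *)
Require Import Defs.
From mathcomp Require Import all_boot all_order all_algebra.
From mathcomp Require Import all_classical all_reals all_analysis.
From mathcomp Require Import measurable_realfun zify lra ring.

(* If the graphs of P shattered arbitrarily large vertex sets, then Ramsey's
   theorem would give, inside P, large graphs whose vertices split into two
   homogeneous halves joined by a prescribed bipartite graph. Taking the
   incidence of points with subsets, a quasirandom bipartite graph, these
   converge to a graphon on two points with the value 1/2, which contradicts
   random-freeness. So the graphs of P have bounded Vapnik-Chervonenkis (VC)
   dimension.

   Given e-separated points of a pure graphon W in the closure of P, replace
   each by a random point of a small ball around it, which has positive measure
   by full support. Then choose random points that one after the other separate
   a proportion of at least e/4 of the pairs of rows not yet separated. The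
   values of W on this sample are the adjacencies of vertices of a graph in P,
   so the Sauer-Shelah lemma bounds the number of rows polynomially in the
   number O(log N / e) of columns. Hence N is polynomial in 1/e; in particular
   the space is totally bounded. *)

Set Implicit Arguments.
Unset Strict Implicit.
Unset Printing Implicit Defensive.

Import Order.TTheory GRing.Theory Num.Theory.
Import numFieldTopology.Exports numFieldNormedType.Exports.

(** * Ramsey and Sauer-Shelah *)

(** Keep the first element [x]: one of its two classes among the rest is large enough for the
    induction on [p + q], and [x] extends a homogeneous sublist of its own kind. *)
Lemma ramsey (T : eqType) (e : rel T) (p q : nat) (s : seq T) :
  (2 ^ (p + q) <= size s)%N ->
  (exists t, [/\ subseq t s, size t = p & pairwise e t]) \/
  (exists t, [/\ subseq t s, size t = q & pairwise (fun x y => ~~ e x y) t]).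
Proof.
have [n] := ubnP (p + q); elim: n p q s => // n IH [|p] q s.
  by move=> _ _; left; exists [::]; rewrite sub0seq.
case: q => [|q]; first by move=> _ _; right; exists [::]; rewrite sub0seq.
case: s => [|x s]; first by rewrite leqn0 expn_eq0.
rewrite ltnS => pqn sz.
have szE : (size [seq y <- s | e x y] + size [seq y <- s | ~~ e x y] = size s)%N.
  by rewrite !size_filter count_predC.
have E1 : (p.+1 + q.+1 = (p + q.+1).+1)%N by lia.
have E2 : (p.+1 + q = p + q.+1)%N by lia.
(* Without [x] at least [2 * w - 1] elements remain, where [w] is the required power of two, so the
   two classes cannot both have fewer than [w]. *)
have [h1|h2] : (2 ^ (p + q.+1) <= size [seq y <- s | e x y])%N \/
     (2 ^ (p.+1 + q) <= size [seq y <- s | ~~ e x y])%N.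
  move: sz; rewrite E1 E2 expnS /= -szE.
  set u := size _; set v := size _; set w := (2 ^ _)%N; lia.
- have [|[t [ts tp te]]|[t [ts tq te]]] := IH p q.+1 _ _ h1; first by lia.
  + left; exists (x :: t); split; rewrite /= ?eqxx ?tp //.
      exact: subseq_trans ts (filter_subseq _ _).
    rewrite te andbT; apply/allP => y /(mem_subseq ts).
    by rewrite mem_filter => /andP[].
  + right; exists t; split => //.
    apply: subseq_trans (subseq_cons _ _).
    exact: subseq_trans ts (filter_subseq _ _).
- have [|[t [ts tp te]]|[t [ts tq te]]] := IH p.+1 q _ _ h2; first by lia.
  + left; exists t; split => //.
    apply: subseq_trans (subseq_cons _ _).
    exact: subseq_trans ts (filter_subseq _ _).
  + right; exists (x :: t); split; rewrite /= ?eqxx ?tq //.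
      exact: subseq_trans ts (filter_subseq _ _).
    rewrite te andbT; apply/allP => y /(mem_subseq ts).
    by rewrite mem_filter => /andP[].
Qed.

Lemma pairwise_nth_neq (T : eqType) (e : rel T) (c : bool) (x0 : T) (t : seq T) :
  symmetric e -> pairwise (fun x y => e x y == c) t ->
  forall i j, (i < size t)%N -> (j < size t)%N -> i != j ->
  e (nth x0 t i) (nth x0 t j) = c.
Proof.
move=> es /(pairwiseP x0) te i j it jt; rewrite neq_ltn => /orP[ij|ji].
  by apply/eqP/te.
by rewrite es; apply/eqP/te.
Qed.

(** Indexing the homogeneous set by a finite type lets structure carried by [I] be transported to
    it. *)
Lemma ramsey_inj (I T : finType) (e : rel T) :
  symmetric e -> (2 ^ (#|I| + #|I|) <= #|T|)%N ->
  exists c (f : I -> T), injective f /\ forall i j, i != j -> e (f i) (f j) = c.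
Proof.
move=> es IT.
have [c [t [ts tp te]]] : exists c t, [/\ subseq t (enum T), size t = #|I| &
    pairwise (fun x y => e x y == c) t].
  have := @ramsey T e #|I| #|I| (enum T); rewrite -cardE => /(_ IT)[]
    [t [ts tI te]]; [exists true, t|exists false, t]; split => //;
    by apply: sub_pairwise te => x y; case: (e x y).
have ut : uniq t by apply: subseq_uniq ts (enum_uniq _).
have [I0|/card_gt0P[i0 _]] := posnP #|I|.
  have noI (i : I) : False by have /card0_eq/(_ i) := I0.
  by exists c, (fun i => False_rect _ (noI i)); split => i; case: (noI i).
have [x0] : exists x0 : T, true.
  have : (0 < size t)%N by rewrite tp; apply/card_gt0P; exists i0.
  by case: t {ts tp te ut} => // x; exists x.
move=> _; exists c, (fun i => nth x0 t (enum_rank i)).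
have lt (i : I) : (enum_rank i < size t)%N by rewrite tp.
split=> [i j /eqP|i j ij].
  by rewrite nth_uniq// => /eqP/val_inj/enum_rank_inj.
apply: pairwise_nth_neq => //.
by apply: contra ij => /eqP/val_inj/enum_rank_inj ->.
Qed.

Section trace.
Variables (I : finType) (Z : eqType) (h : I -> Z -> bool).
Implicit Types (A : {set I}) (s z : seq Z).

(** Since every boolean pattern occurs, the entries of a shattered list are distinct, so [size s]
    counts points. *)
Definition shattered s A := forall tau : seq bool, size tau = size s ->
  exists2 i, i \in A & [seq h i y | y <- s] = tau.

(** Induction on [z]. If many traces on [z] extend both ways at [x], then [k] points shattered by
    them can be joined by [x]; otherwise, removing one row of each such pair leaves enough rows with
    distinct traces on [z]. *)
Lemma sauer_shelah (k : nat) z A :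
  {in A &, injective (fun i => [seq h i y | y <- z])} ->
  ((size z).+1 ^ k < #|A|)%N ->
  exists s, [/\ size s = k, {subset s <= z} & shattered s A].
Proof.
elim: z k A => [|x z IH] k A sepA.
  rewrite /= exp1n => /card_gt1P[i [j [iA jA]]] /eqP[].
  exact: sepA.
case: k => [|k] cA.
  exists [::]; split => // -[]// _.
  by have /card_gt0P[i iA] : (0 < #|A|)%N by [apply: leq_trans cA]; exists i.
pose B := [set i in A | h i x &
   [exists j in A, ~~ h j x && ([seq h i y | y <- z] == [seq h j y | y <- z])]].
have BA : B \subset A by apply/fintype.subsetP => i; rewrite inE => /andP[].
have [hB|hB] := ltnP ((size z).+1 ^ k) #|B|.
  have [|s [sk sz sh]] := IH k B _ hB.
    move=> i j; rewrite !inE => /and3P[iA hi _] /and3P[jA hj _] ij.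
    by apply: sepA => //=; rewrite hi hj ij.
  exists (x :: s); split; first by rewrite /= sk.
    by move=> y; rewrite !inE => /orP[->//|/sz ->]; rewrite orbT.
  move=> [//|b tau] /= [/sh[i]]; rewrite inE => /and3P[iA hi /exists_inP[j jA]].
  move=> /andP[hj /eqP ij] tauE; case: b; first by exists i => //; rewrite hi tauE.
  exists j => //; rewrite (negbTE hj) -tauE; congr cons.
  have /eq_in_map E : {in z, h i =1 h j} by apply/eq_in_map.
  by apply/eq_in_map => y /sz yz; apply/esym; move: y yz; apply/eq_in_map.
have [||s [sk sz sh]] := IH k.+1 (A :\: B).
- move=> i j; rewrite !finset.in_setD => /andP[iB iA] /andP[jB jA] ij.
  apply: sepA => //=; rewrite ij; congr cons.
  move: iB jB; rewrite !inE iA jA /=.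
  have [hi|hi] := boolP (h i x); have [hj|hj] := boolP (h j x) => //=.
    by move=> /exists_inPn/(_ j jA); rewrite hj ij eqxx.
  by move=> _ /exists_inPn/(_ i iA); rewrite hi ij eqxx.
(* The count uses [(n + 2) ^ (k + 1) >= (n + 1) ^ (k + 1) + (n + 1) ^ k], with [n] the size of
   [z]. *)
- have := cardsID B A; rewrite (finset.setIidPr BA).
  move: cA hB; rewrite /= !expnS.
  have : ((size z).+1 ^ k <= (size z).+2 ^ k)%N.
    by case: (k) => // k'; rewrite leq_exp2r.
  set a := (_ ^ k)%N; set b := (_ ^ k)%N; nia.
exists s; split => //.
  by move=> y /sz; rewrite inE => ->; rewrite orbT.
by move=> tau /sh[i]; rewrite finset.in_setD => /andP[_ iA]; exists i.
Qed.

End trace.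

(** * Shattering in graphs of a hereditary property *)

Definition shatters (G : sgraph) (k : nat) : Prop :=
  exists2 s : seq G, size s = k & shattered (@edge G) s [set: G].

Lemma shatters_fun (G : sgraph) (K : finType) : shatters G #|K| ->
  exists a : K -> G, forall phi : K -> bool,
    exists v, forall i, edge v (a i) = phi i.
Proof.
move=> [s sK sh]; have /card_gt0P[x0 _] := vertex_gt0 G.
exists (fun i => nth x0 s (enum_rank i)) => phi.
have [|v _ vE] := sh [seq phi i | i <- enum K].
  by rewrite size_map -cardE sK.
exists v => i; have ltsi : (enum_rank i < size s)%N by rewrite sK.
rewrite -(nth_map x0 false (edge v) ltsi) vE (nth_map i); last first.
  by rewrite -cardE.
by rewrite nth_enum_rank.
Qed.

(* Ramsey's theorem applied first to the shattered vertices, then to the vertices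
   cutting out their coordinate subsets. The two sides are disjoint because a
   vertex of the first side is adjacent to all or none of the others there. *)
Lemma bigraph_in_shattering (I J : finType) (M : I -> J -> bool) (i0 : I)
    (j0 : J) : exists K, forall G, shatters G K ->
  exists (c : bool -> bool) (a : I -> G) (b : J -> G),
    [/\ injective a, injective b, forall i j, a i <> b j,
        (forall i i', i != i' -> edge (a i) (a i') = c false) /\
        (forall j j', j != j' -> edge (b j) (b j') = c true) &
        forall i j, edge (a i) (b j) = M i j].
Proof.
(* Each [i] gets one copy for every subset of ['I_m], so that vertices [b j], for [j] in ['I_m], can
   be chosen adjacent to exactly the copies whose subset contains [j]. The size [m] leaves room for
   Ramsey's theorem among the [b j]. *)
pose m := (2 ^ (#|J| + #|J|))%N; pose L := (I * {ffun 'I_m -> bool})%type.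
exists (2 ^ (#|{: L}| + #|{: L}|))%N => G.
rewrite -[X in shatters _ X]card_ord => /shatters_fun[a0 a0P].
have [||cA [h [hI hP]]] := @ramsey_inj L 'I_(2 ^ (#|{: L}| + #|{: L}|))
  (fun i i' => edge (a0 i) (a0 i')).
- by move=> i i'; rewrite edge_sym.
- by rewrite card_ord.
pose a l := a0 (h l).
have aP (phi : L -> bool) : exists v, forall l, edge v (a l) = phi l.
  have [v vP] := a0P (fun i => [exists l, (h l == i) && phi l]).
  exists v => l; rewrite vP; apply/existsP/idP => [[l' /andP[/eqP/hI ->//]]|pl].
  by exists l; rewrite eqxx.
have aI : injective a.
  move=> l l' all'; have [v vP] := aP (pred1 l).
  by have := vP l'; rewrite -all' vP /= eqxx => /esym/eqP.
have /fin_all_exists[b bP] (j : 'I_m) :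
    exists v : G, forall l, edge v (a l) = l.2 j.
  exact: (aP (fun l : L => l.2 j)).
have bI : injective b.
  move=> j j' bjj'.
  pose l : L := (i0, [ffun x => x == j]).
  by have := bP j l; rewrite bjj' bP /= !ffunE eqxx => /eqP.
have ab l j : a l <> b j.
  move=> alj.
  have [j2 j2j] : exists j2 : 'I_m, j2 != j.
    apply/existsP; rewrite -[[exists _, _]]negbK negb_exists; apply/negP => /forallP H.
    have : (#|'I_m| <= 1)%N.
      apply/card_le1_eqP => x y _ _; have := H x; have := H y.
      by rewrite !negbK => /eqP -> /eqP ->.
    rewrite card_ord leqNgt /m -[X in (X < _)%N]/(2 ^ 0)%N ltn_exp2l//.
    by rewrite addn_gt0; have -> : (0 < #|J|)%N by apply/card_gt0P; exists j0.
  (* The copy [l'] differs from [l] at [j2], and its value at [j] contradicts the homogeneous value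
     [cA] if [a l = b j]. *)
  pose l' : L := (i0, [ffun x => if x == j then ~~ cA else ~~ l.2 j2]).
  have l'l : l != l'.
    apply/eqP => /(congr1 (fun u : L => u.2 j2)); rewrite /= ffunE (negbTE j2j).
    by case: (l.2 j2).
  have := bP j l'; rewrite -alj /a hP//= ffunE eqxx.
  by case: (cA).
have [||cB [g [gI gP]]] := @ramsey_inj J 'I_m (fun i i' => edge (b i) (b i')).
- by move=> i i'; rewrite edge_sym.
- by rewrite card_ord.
(* Among the copies of [i], take the one whose subset is row [i] of [M], carried into ['I_m] by
   [g]. *)
pose al i : L := (i, [ffun x => [exists j, (g j == x) && M i j]]).
have alI : injective al by move=> i i' [].
exists (fun x => if x then cB else cA), (a \o al), (b \o g); split.
- exact: inj_comp.
- exact: inj_comp.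
- by move=> i j; exact: ab.
- split=> [i i' ii'|j j' jj'] /=; last by rewrite gP.
  by rewrite /a hP//; apply: contra ii' => /eqP/alI ->.
- move=> i j /=; rewrite edge_sym bP /= ffunE.
  apply/existsP/idP => [[j' /andP[/eqP/gI ->//]]|Mij].
  by exists j; rewrite eqxx.
Qed.

(** [H] is isomorphic to the subgraph of [G] induced on the image of [f]. *)
Lemma embedding_property (P : sgraph -> Prop) (G H : sgraph) (f : H -> G) :
  graph_property P -> hereditary P -> injective f ->
  (forall x y, edge (f x) (f y) = edge x y) -> P G -> P H.
Proof.
move=> P_iso P_hered fI fE PG; have /card_gt0P[x0 _] := vertex_gt0 H.
have Sx0 : f x0 \in [set f x | x : H] by apply: imset_f.
apply: (P_iso (induced_graph Sx0)); last exact: P_hered.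
have ex (u : induced_graph Sx0) : exists x, f x == val u.
  by case: u => /= u /imsetP[x _ ->]; exists x.
pose g u := xchoose (ex u).
have gE u : f (g u) = val u by apply/eqP; exact: (xchooseP (ex u)).
exists g; last by move=> x y; rewrite -fE !gE.
have Sx x : f x \in [set f x | x : H] by apply: imset_f.
exists (fun x => exist _ (f x) (Sx x)) => [u|x].
  by apply/val_inj; rewrite /= gE.
by apply: fI; rewrite gE.
Qed.

Section two_sided.
Variables (V : finType) (v0 : V) (c : bool -> bool) (M : rel V).

Definition two_sided_edge : rel (bool * V) := fun p q =>
  match p.1, q.1 with
  | false, true => M p.2 q.2
  | true, false => M q.2 p.2
  | _, _ => (p.2 != q.2) && c p.1
  end.

Lemma two_sided_edge_sym : symmetric two_sided_edge.
Proof. by move=> [[] v] [[] w]; rewrite /two_sided_edge //= eq_sym. Qed.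

Lemma two_sided_edge_irrefl : irreflexive two_sided_edge.
Proof. by move=> [[] v]; rewrite /two_sided_edge /= eqxx. Qed.

Lemma two_sided_gt0 : (0 < #|{: bool * V}|)%N.
Proof. by apply/card_gt0P; exists (true, v0). Qed.

Definition two_sided_graph : sgraph :=
  SGraph two_sided_edge_sym two_sided_edge_irrefl two_sided_gt0.

End two_sided.

(** Ramsey's theorem decides whether each side is complete or empty, so [c] is found while [M] is
    prescribed. *)
Lemma two_sided_in_shattering (P : sgraph -> Prop) (V : finType) (v0 : V)
    (M : rel V) : graph_property P -> hereditary P ->
  exists K, forall G, P G -> shatters G K -> exists c, P (two_sided_graph v0 c M).
Proof.
move=> P_iso P_hered; have [K HK] := bigraph_in_shattering M v0 v0.
exists K => G PG /HK[c [a [b [aI bI ab [cA cB] MP]]]]; exists c.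
pose f (p : two_sided_graph v0 c M) := if p.1 then b p.2 else a p.2.
apply: (@embedding_property P G _ f) => //.
  move=> [[] v] [[] w]; rewrite /f /=.
  - by move=> /bI ->.
  - by move=> /esym/ab.
  - by move=> /ab.
  - by move=> /aI ->.
move=> p q; rewrite -[RHS]/(two_sided_edge c M p q) /two_sided_edge /f.
move: p q => [[] v] [[] w] /=.
- by case: eqVneq => [->|/cB//]; exact: edge_irrefl.
- by rewrite edge_sym.
- exact: MP.
- by case: eqVneq => [->|/cA//]; exact: edge_irrefl.
Qed.

(** * A random-free property does not shatter large sets *)

Local Open Scope classical_set_scope.
Local Open Scope ring_scope.

Lemma integrable01 (R : realType) (d : measure_display) (T : measurableType d)
    (mu : probability T R) (f : T -> R) :
  measurable_fun setT f -> (forall x, 0 <= f x) -> (forall x, f x <= 1) ->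
  mu.-integrable setT (EFin \o f).
Proof.
move=> mf f0 f1; apply: measurable_bounded_integrable => //.
  by apply: (le_lt_trans (probability_le1 _ _)) => //; rewrite ltry.
exists 1; split=> [|r r1 x _]; first exact: num_real.
rewrite /= ger0_norm//; exact: le_trans (f1 x) (ltW r1).
Qed.

Lemma Rintegral_fintype (R : realType) (d : measure_display)
    (T : measurableType d) (mu : probability T R) (I : finType) (e : I -> T)
    (f : T -> R) :
  bijective e -> (forall i, measurable [set e i]) ->
  \int[mu]_x f x = \sum_i f (e i) * fine (mu [set e i]).
Proof.
move=> eb me.
have mi i : measurable_fun setT ((\1_[set e i] : T -> R)).
  exact: measurable_indic.
have fE x : (f x)%:E = (\sum_i (f (e i) * \1_[set e i] x)%:E)%E.
  case: (eb) => g ge eg.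
  rewrite sumEFin (bigD1 (g x))//= eg indicE mem_set// mulr1 big1 ?addr0// => i ix.
  rewrite indicE memNset ?mulr0//= => xE; move: ix; rewrite xE ge eqxx//.
have ii i : mu.-integrable setT (EFin \o (\1_[set e i] : T -> R)).
  by apply: integrable01 => // x; rewrite indicE ?ler0n// lern1 leq_b1.
rewrite /Rintegral (eq_integral _ _ (fun x _ => fE x)).
rewrite integral_sum//; last first.
  move=> i; under eq_fun do rewrite EFinM.
  exact: (integrableZl measurableT (f (e i)) (ii i)).
have iE i : (\int[mu]_x (f (e i) * \1_[set e i] x)%:E =
    (f (e i) * fine (mu [set e i]))%:E)%E.
  rewrite (integralZl measurableT (ii i)) integral_indic// setIT.
  by rewrite EFinM fineK ?fin_num_measure.
under eq_bigr do rewrite iE.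
by rewrite sumEFin.
Qed.

Section finite_graph.
Context {R : realType} (G : sgraph).
Let V := vertex_space G.
Let mu := Defs.uniform_prob R G.

(** The coordinates generate the sigma-algebra, so a singleton is a finite intersection of
    measurable fibres. *)
Lemma measurable_tuple_vertex (n : nat) (A : set (n.-tuple V)) : measurable A.
Proof.
have -> : A = \bigcup_(t in A) [set t].
  by rewrite bigcup_imset1 image_id.
apply: fin_bigcup_measurable; first exact: finite_finset.
move=> t _.
have -> : [set t] = \bigcap_(i in [set: 'I_n])
    ((@tnth n V ^~ i) @^-1` [set tnth t i]).
  apply/seteqP; split=> [u -> i _//|u tu].
  by apply/eq_from_tnth => i; exact: tu.
apply: fin_bigcap_measurable; first exact: finite_finset.
by move=> i _; rewrite -[X in measurable X]setTI; exact: measurable_tnth.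
Qed.

Lemma uniform_prob1 (v : V) : mu [set v] = (#|G|%:R^-1)%:E.
Proof.
have -> : [set v] = [set` [set v : G]%SET].
  by apply/seteqP; split=> x /=; rewrite inE => /eqP.
by rewrite /mu uniform_probE cards1 mul1r.
Qed.

Lemma tuple_uniform_prob1 (n : nat) (t : n.-tuple V) :
  tuple_measure mu n [set t] = ((#|G|%:R ^+ n)^-1)%:E.
Proof.
elim: n t => [|n IH] t.
  by rewrite /= diracE expr0 invr1 mem_set//= (tuple0 t).
rewrite /= /cons_measure /pushforward.
have -> : @cons_pair _ V n @^-1` [set t] = [set thead t] `*` [set behead_tuple t].
  apply/seteqP; split=> -[v u] /=.
    by move=> <-; rewrite /= theadE; split => //; apply/val_inj.
  by move=> [-> ->]; rewrite [RHS]tuple_eta; apply/val_inj.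
rewrite product_measure1E//; last exact: measurable_tuple_vertex.
rewrite exprS invfM EFinM; congr (_ * _)%E; [exact: uniform_prob1|exact: IH].
Qed.

Lemma Rintegral_tuple_uniform (n : nat) (f : n.-tuple V -> R) :
  \int[tuple_measure mu n]_t f t = (\sum_t f t) / #|G|%:R ^+ n.
Proof.
rewrite (@Rintegral_fintype _ _ _ _ (n.-tuple V) id)//; last 2 first.
- by exists id.
- by move=> t; exact: measurable_tuple_vertex.
rewrite mulr_suml; apply: eq_bigr => t _.
by rewrite tuple_uniform_prob1.
Qed.

End finite_graph.

(** * Densities of the incidence graphs *)

Definition ordered_edges (F : sgraph) : {set F * F} :=
  [set p : F * F | edge p.1 p.2 && (enum_rank p.1 < enum_rank p.2)%N]%SET.

Lemma hom_densityE (R : realType) (d : measure_display) (J : measurableType d)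
    (mu : probability J R) (W : J * J -> R) (F : sgraph) :
  hom_density mu W F = \int[tuple_measure mu #|F|]_x
    \prod_(p in ordered_edges F)
      W (tnth x (enum_rank p.1), tnth x (enum_rank p.2)).
Proof.
apply: eq_Rintegral => x _; rewrite pair_big_dep.
by apply: eq_bigl => p; rewrite inE.
Qed.

(** For independent fair bits, the expectation of a product over distinct indices is the product of
    the expectations. *)
Lemma sum_prod_indicator (R : realType) (A : finType) (D : {set A}) :
  \sum_(y : {ffun A -> bool}) \prod_(d in D) (y d)%:R =
  2 ^+ #|A| * \prod_(d in D) (2^-1 : R).
Proof.
rewrite (eq_bigr (fun y : {ffun A -> bool} =>
    \prod_d (if d \in D then (y d)%:R else 1))); last first.
  by move=> y _; rewrite big_mkcond.
rewrite -(bigA_distr_bigA (fun d (b : bool) => if d \in D then b%:R else 1 : R)).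
have <- : \prod_(d : A) (2 : R) = 2 ^+ #|A| by rewrite prodr_const.
rewrite [X in _ = _ * X]big_mkcond -big_split /=.
apply: eq_bigr => d _; rewrite big_bool /=.
by case: ifP => _; rewrite ?addr0 ?expr1 ?mulr1// divff.
Qed.

Definition blowup_rel (k : nat) : rel ('I_k.+1 * {ffun 'I_k.+1 -> bool}) :=
  fun v w => w.2 v.1.

(* The bipartite pattern of the two sides is the incidence of points with
   subsets, each blown up so that the two sides have equal size. *)
Definition incidence_graph (c : bool -> bool) (k : nat) : sgraph :=
  two_sided_graph (ord0, [ffun=> true]) c (@blowup_rel k).

(** The limit of the incidence graphs: a random subset contains a given point with probability 1/2,
    which is the value across the sides. *)
Definition two_point_graphon (R : realType) (c : bool -> bool)
    (p : bool * bool) : R := if p.1 == p.2 then (c p.1)%:R else 2^-1.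

Section incidence_graph_density.
Context {R : realType} (c : bool -> bool) (F : sgraph) (k : nat).
Let n := #|F|.
(** A tuple of vertices is split into sides, points and membership bits, so that a sum over tuples
    becomes an iterated sum. *)
Let X : finType := ({ffun F -> bool} * ({ffun F -> 'I_k.+1} *
   {ffun F * 'I_k.+1 -> bool}))%type.
Let V : finType := ('I_k.+1 * {ffun 'I_k.+1 -> bool})%type.

Let vtx (x : X) (u : F) : bool * V :=
  (x.1 u, (x.2.1 u, [ffun a => x.2.2 (u, a)])).

Let g (x : X) : n.-tuple (bool * V) := [tuple vtx x (enum_val i) | i < n].

Let g_bij : bijective g.
Proof.
pose g' (t : n.-tuple (bool * V)) : X :=
  ([ffun u => (tnth t (enum_rank u)).1],
   ([ffun u => (tnth t (enum_rank u)).2.1],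
    [ffun p => (tnth t (enum_rank p.1)).2.2 p.2])).
exists g' => [[s [i y]]|t].
  rewrite /g'; congr (_, (_, _)); apply/ffunP => u;
    rewrite ffunE tnth_mktuple enum_rankK//=.
  by rewrite ffunE; case: u.
apply/eq_from_tnth => j; rewrite tnth_mktuple /vtx /= !ffunE enum_valK.
case E : (tnth t j) => [b [v w]] /=; congr (_, (_, _)).
by apply/ffunP => a; rewrite !ffunE/= enum_valK E.
Qed.

Let f (x : X) : R :=
  \prod_(p in ordered_edges F)
    (two_sided_edge c (@blowup_rel k) (vtx x p.1) (vtx x p.2))%:R.

Let w (s : {ffun F -> bool}) : R :=
  \prod_(p in ordered_edges F) two_point_graphon R c (s p.1, s p.2).

Let f01 x : 0 <= f x <= 1.
Proof.
apply/andP; split; first by apply: prodr_ge0 => p _; rewrite ler0n.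
by apply: prodr_ile1 => p _; rewrite ler0n lern1 leq_b1.
Qed.

Let w01 s : 0 <= w s <= 1.
Proof.
have h p : 0 <= two_point_graphon R c p <= 1.
  rewrite /two_point_graphon; case: ifP => _; first by rewrite ler0n lern1 leq_b1.
  by rewrite invr_ge0 ler0n invf_le1// ler1n.
apply/andP; split; first by apply: prodr_ge0 => p _; case/andP: (h (s p.1, s p.2)).
exact: prodr_ile1.
Qed.

(** When the points are distinct, the edges of [F] across the sides read distinct membership bits,
    and the edges within a side join distinct vertices and contribute [c]. *)
Let f_inj (s : {ffun F -> bool}) (i : {ffun F -> 'I_k.+1}) : injective i ->
  \sum_y f (s, (i, y)) = 2 ^+ (n * k.+1) * w s.
Proof.
move=> iI.
pose cross := [set p in ordered_edges F | s p.1 != s p.2]%SET.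
(* The bit read by a cross edge: its end on the [true] side supplies the subset, the other end the
   point. *)
pose phi (p : F * F) : F * 'I_k.+1 := if s p.1 then (p.1, i p.2) else (p.2, i p.1).
have phiI : {in cross &, injective phi}.
  move=> [a b] [a' b']; rewrite !inE /=.
  move=> /andP[/andP[_ ab] sab] /andP[/andP[_ ab'] sab'].
  rewrite /phi /=; move: sab sab'.
  case: (boolP (s a)) => sa /=; case: (boolP (s a')) => sa' /= sb sb' [].
  - by move=> -> /iI ->.
  - by move=> aE /iI bE; move: ab ab'; rewrite aE bE => /ltn_trans h /h; rewrite ltnn.
  - by move=> bE /iI aE; move: ab ab'; rewrite aE bE => /ltn_trans h /h; rewrite ltnn.
  - by move=> -> /iI ->.
pose C : R := \prod_(p in ordered_edges F | s p.1 == s p.2) (c (s p.1))%:R.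
have fE y : f (s, (i, y)) = C * \prod_(d in phi @: cross) (y d)%:R.
  rewrite big_imset//= /f (bigID (fun p : F * F => s p.1 == s p.2)) /=; congr (_ * _).
    apply: eq_bigr => -[a b] /= /andP[]; rewrite inE /= => /andP[_ ab] /eqP sab.
    have ne : (vtx (s, (i, y)) a).2 != (vtx (s, (i, y)) b).2.
      by apply/eqP => -[/iI ab' _]; move: ab; rewrite ab' ltnn.
    by congr (_%:R); rewrite /two_sided_edge ne /= -sab; case: (s a).
  apply: eq_big => [p|p /andP[_ sp]]; first by rewrite /cross !inE.
  congr (_%:R); rewrite /two_sided_edge /phi /=; move: sp.
  by case: (s p.1); case: (s p.2) => //= _; rewrite /blowup_rel /= ffunE.
under eq_bigr do rewrite fE.
rewrite -mulr_sumr sum_prod_indicator card_prod card_ord mulrCA; congr (_ * _).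
rewrite big_imset//= /w [in RHS](bigID (fun p : F * F => s p.1 == s p.2)) /=.
congr (_ * _).
  by apply: eq_bigr => p /andP[_ sp]; rewrite /two_point_graphon /= sp.
apply: eq_big => p; rewrite /cross inE// => /andP[_ sp].
by rewrite /two_point_graphon /= (negbTE sp).
Qed.

(** Injective choices of points cancel exactly; each of the others contributes at most the number of
    bit patterns. *)
Let fw_dist (s : {ffun F -> bool}) :
  `|\sum_i \sum_y f (s, (i, y)) - k.+1%:R ^+ n * 2 ^+ (n * k.+1) * w s|
    <= (k.+1 ^ n - k.+1 ^_ n)%:R * 2 ^+ (n * k.+1).
Proof.
have N0 : 0 <= 2 ^+ (n * k.+1) :> R by apply: exprn_ge0.
have cardk : #|{ffun F -> 'I_k.+1}| = (k.+1 ^ n)%N by rewrite card_ffun card_ord.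
have -> : k.+1%:R ^+ n * 2 ^+ (n * k.+1) * w s =
    \sum_(i : {ffun F -> 'I_k.+1}) 2 ^+ (n * k.+1) * w s.
  by rewrite sumr_const cardk -natrX -[RHS]mulr_natl mulrA.
rewrite -sumrB; apply: le_trans (ler_norm_sum _ _ _) _.
rewrite (bigID (fun i : {ffun F -> 'I_k.+1} => injectiveb i)) /= big1; last first.
  by move=> i /injectiveP/f_inj ->; rewrite subrr normr0.
rewrite add0r.
have -> : (k.+1 ^ n - k.+1 ^_ n)%:R * 2 ^+ (n * k.+1) =
    \sum_(i : {ffun F -> 'I_k.+1} | ~~ injectiveb i) (2 ^+ (n * k.+1) : R).
  rewrite sumr_const mulr_natl; congr (_ *+ _).
  have := cardC [pred i : {ffun F -> 'I_k.+1} | injectiveb i].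
  rewrite cardk => <-; rewrite -cardsE card_inj_ffuns card_ord addnC addnK.
  by [].
apply: ler_sum => i _.
have cardy : #|{ffun F * 'I_k.+1 -> bool}| = (2 ^ (n * k.+1))%N.
  by rewrite card_ffun card_bool card_prod card_ord.
have s1 : 0 <= \sum_y f (s, (i, y)) <= 2 ^+ (n * k.+1).
  apply/andP; split; first by apply: sumr_ge0 => y _; case/andP: (f01 (s, (i, y))).
  rewrite -natrX -cardy -sum1_card natr_sum; apply: ler_sum => y _.
  by case/andP: (f01 (s, (i, y))).
have s2 : 0 <= 2 ^+ (n * k.+1) * w s <= 2 ^+ (n * k.+1).
  by case/andP: (w01 s) => w0 w1; rewrite mulr_ge0//= ler_piMr.
rewrite ler_norml; move: s1 s2 => /andP[? ?] /andP[? ?].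
by apply/andP; split; lra.
Qed.

(** The error bound is the probability that [n] independent uniform points of ['I_k.+1] are not
    distinct. *)
Lemma incidence_graph_density_dist :
  `|hom_density (Defs.uniform_prob R (incidence_graph c k))
      (@graph_graphon R (incidence_graph c k)) F -
    (\sum_(s : {ffun F -> bool}) w s) / 2 ^+ n|
    <= (k.+1 ^ n - k.+1 ^_ n)%:R / k.+1%:R ^+ n.
Proof.
have cH : #|incidence_graph c k| = (2 * (k.+1 * 2 ^ k.+1))%N.
  by rewrite card_prod card_bool card_prod card_ord card_ffun card_bool card_ord.
rewrite hom_densityE Rintegral_tuple_uniform cH -/n.
set S := (X in `|X / _ - _|).
have -> : S = \sum_s \sum_i \sum_y f (s, (i, y)).
  transitivity (\sum_(x : X) f x).
    rewrite /S (reindex g) /=; last exact: onW_bij.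
    apply: eq_bigr => x _; apply: eq_bigr => p _.
    by rewrite /graph_graphon !tnth_mktuple !enum_rankK.
  rewrite -(pair_bigA _ (fun s q => f (s, q))) /=; apply: eq_bigr => s _.
  by rewrite -(pair_bigA _ (fun i y => f (s, (i, y)))).
(* The number of vertex tuples, factored into sides, points and bits. *)
pose N : R := 2 ^+ n * (k.+1%:R ^+ n * 2 ^+ (n * k.+1)).
have -> : (2 * (k.+1 * 2 ^ k.+1))%:R ^+ n = N.
  by rewrite /N !natrM !exprMn natrX -exprM mulnC.
have N2 : 2 ^+ n != 0 :> R by rewrite expf_neq0// pnatr_eq0.
have Nk : k.+1%:R ^+ n != 0 :> R by rewrite expf_neq0// pnatr_eq0.
have Ny : 2 ^+ (n * k.+1) != 0 :> R by rewrite expf_neq0// pnatr_eq0.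
have Npos : 0 < N by rewrite !mulr_gt0// exprn_gt0// ltr0n.
have -> : (\sum_s w s) / 2 ^+ n =
    (\sum_s k.+1%:R ^+ n * 2 ^+ (n * k.+1) * w s) / N.
  by rewrite -mulr_sumr /N; field; rewrite N2 Nk Ny.
rewrite -mulrBl -sumrB normrM (ger0_norm (_ : 0 <= N^-1)); last first.
  by rewrite invr_ge0 ltW.
rewrite ler_pdivrMr//; apply: le_trans (ler_norm_sum _ _ _) _.
apply: le_trans (ler_sum _ (fun s _ => fw_dist s)) _.
rewrite sumr_const card_ffun card_bool -/n -[leLHS]mulr_natl natrX /N.
rewrite le_eqVlt; apply/orP; left; apply/eqP; field; exact: Nk.
Qed.

End incidence_graph_density.

(** The birthday bound: [n] random points among [K] collide with probability at most [n ^ 2 / K]. *)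
Lemma expn_sub_ffact (K n : nat) :
  ((K ^ n - K ^_ n) * K <= n ^ 2 * K ^ n)%N.
Proof.
elim: n => [|n IH]; first by rewrite ffactn0 subnn.
rewrite ffactnSr !expnS; have [Kn|/ltnW nK] := leqP K n.
  rewrite (_ : K - n = 0)%N; last by lia.
  by rewrite muln0 subn0; set a := (K ^ n)%N; nia.
have : (K ^_ n <= K ^ n)%N.
  rewrite ffact_prod -[X in (_ <= _ ^ X)%N]card_ord -prod_nat_const.
  by apply: leq_prod => i _; rewrite leq_subr.
move: IH; set a := (K ^ n)%N; set b := (K ^_ n)%N => IH ba.
have -> : (b * (K - n) = b * K - b * n)%N by rewrite mulnBr.
have -> : (K * a - (b * K - b * n) = K * (a - b) + b * n)%N by nia.
rewrite mulnDl.
have h1 : (K * (a - b) * K <= K * (n ^ 2 * a))%N by rewrite -mulnA leq_mul2l IH orbT.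
have h2 : (b * n * K <= a * n * K)%N by rewrite !leq_mul2r ba !orbT.
nia.
Qed.

Lemma measurable_vertex_pair (G : sgraph)
  (A : set (vertex_space G * vertex_space G)) : measurable A.
Proof.
have -> : A = \bigcup_(t in A) ([set t.1] `*` [set t.2]).
  apply/seteqP; split=> [p Ap|p [q Aq [/= p1 p2]]]; first by exists p.
  by move: Aq; rewrite [p]surjective_pairing p1 p2 -surjective_pairing.
apply: fin_bigcup_measurable; first exact: finite_finset.
by move=> t _; exact: measurableX.
Qed.

(** Supplies the uniform two-point probability space on which the limit graphon lives. *)
Definition two_points : sgraph :=
  @SGraph bool (fun _ _ => false) (fun _ _ => erefl) (fun _ => erefl)
    (ltac:(by rewrite card_bool)).

Section discrete_metric.
Context (R : realType) (G : sgraph).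
Let r (x y : vertex_space G) : R := (x != y)%:R.

Let r_metric : is_metric r.
Proof.
split=> [x|x y|x y|y x z].
- by rewrite /r eqxx.
- by rewrite /r; case: eqVneq => //= _ /eqP; rewrite oner_eq0.
- by rewrite /r eq_sym.
- rewrite /r; case: (eqVneq x z) => [_|xz] /=; first by rewrite addr_ge0// ler0n.
  case: (eqVneq x y) xz => [->|_] xz; first by rewrite xz add0r.
  by rewrite lerDl ler0n.
Qed.

Let ball1 (x : metric_space r_metric) : ball x 1 = [set x].
Proof.
rewrite ballEmdist; apply/seteqP; split=> y /=; last first.
  by move=> ->; rewrite mdistxx.
rewrite -[mdist x y]/(r x y) /r; case: eqVneq => //= _.
by rewrite ltxx.
Qed.

Lemma standard_borel_vertex_space : standard_borel R (vertex_space G).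
Proof.
exists r, r_metric; split.
- move=> F FF /cauchyP /(_ 1) [//|x]; rewrite ball1 => Fx.
  by exists x => U /nbhs_singleton Ux; apply: filterS Fx => y ->.
- exists setT; first exact: (@finite_set_countable _ _ (@finite_finset G setT)).
  by move=> U [x Ux] _; exists x.
- apply/seteqP; split=> A // _; apply: sub_sigma_algebra => /=.
  rewrite openE => x Ax; apply/nbhs_ballP; exists 1 => //=.
  by rewrite ball1 => _ ->.
Qed.

End discrete_metric.

Section two_point.
Context (R : realType).

Lemma two_point_graphonP (c : bool -> bool) :
  @is_graphon R _ (vertex_space two_points) (two_point_graphon R c).
Proof.
have h p : 0 <= two_point_graphon R c p <= 1.
  rewrite /two_point_graphon; case: ifP => _; first by rewrite ler0n lern1 leq_b1.
  by rewrite invr_ge0 ler0n invf_le1// ler1n.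
split.
- exact: standard_borel_vertex_space.
- by move=> x y; rewrite /two_point_graphon /= eq_sym; case: eqVneq => // ->.
- move=> _ Y mY; rewrite setTI.
  exact: measurable_vertex_pair.
- by move=> p; case/andP: (h p).
- by move=> p; case/andP: (h p).
Qed.

Lemma hom_density_two_point (c : bool -> bool) (F : sgraph) :
  hom_density (Defs.uniform_prob R two_points) (two_point_graphon R c) F =
  (\sum_(s : {ffun F -> bool})
     \prod_(p in ordered_edges F) two_point_graphon R c (s p.1, s p.2)) /
  2 ^+ #|F|.
Proof.
rewrite hom_densityE Rintegral_tuple_uniform card_bool; congr (_ / _).
pose g (s : {ffun F -> bool}) : #|F|.-tuple bool := [tuple s (enum_val i) | i < #|F|].
have gb : bijective g.
  exists (fun t => [ffun u => tnth t (enum_rank u)]) => [s|t].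
    by apply/ffunP => u; rewrite ffunE tnth_mktuple enum_rankK.
  by apply/eq_from_tnth => i; rewrite tnth_mktuple ffunE enum_valK.
rewrite (reindex g) /=; last exact: onW_bij.
apply: eq_bigr => s _; apply: eq_bigr => p _.
by rewrite !tnth_mktuple !enum_rankK.
Qed.

(** The sizes may skip values because a fixed [c] is only known to occur for arbitrarily large
    [k]. *)
Lemma incidence_graph_converges (c : bool -> bool) (k : nat -> nat) :
  (forall n, (n <= k n)%N) ->
  converges_to (fun n => incidence_graph c (k n)) (Defs.uniform_prob R two_points)
    (two_point_graphon R c).
Proof.
move=> nk; split.
  apply/cvgnyPge => A; near=> n.
  have An : (A <= n)%N by near: n; exact: nbhs_infty_ge.
  rewrite card_prod card_bool card_prod card_ord card_ffun card_bool card_ord.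
  have : (0 < 2 ^ (k n).+1)%N by rewrite expn_gt0.
  by set a := (2 ^ _)%N; have := nk n; nia.
move=> F; apply/cvgrPdist_le => e e0; near=> n.
(* From this [n] on, the birthday bound is at most [e]. *)
have ne : (#|F| ^ 2)%:R / e <= n%:R by near: n; exact: nbhs_infty_ger.
rewrite distrC hom_density_two_point; apply: le_trans (incidence_graph_density_dist _ _ _) _.
have K0 : 0 < ((k n).+1)%:R :> R by rewrite ltr0n.
rewrite ler_pdivrMr ?exprn_gt0// -(ler_pM2r K0) -natrM.
apply: (@le_trans _ _ (#|F| ^ 2 * (k n).+1 ^ #|F|)%:R).
  by rewrite ler_nat; exact: expn_sub_ffact.
rewrite natrM (natrX _ (k n).+1) mulrAC ler_wpM2r// ?exprn_ge0 ?ler0n//.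
move: ne; rewrite ler_pdivrMr// mulrC => /le_trans; apply.
by rewrite ler_pM2l// ler_nat; exact: leq_trans (nk n) _.
Unshelve. all: by end_near. Qed.

Lemma two_point_not_01 (c : bool -> bool) :
  ~ {ae (Defs.uniform_prob R two_points \x Defs.uniform_prob R two_points)%E,
     forall p, two_point_graphon R c p = 0 \/ two_point_graphon R c p = 1}.
Proof.
case=> N [mN N0 subN].
pose mu := Defs.uniform_prob R two_points.
have m1 (b : vertex_space two_points) : measurable [set b] by [].
have : ((mu \x mu) ([set false : vertex_space two_points] `*`
    [set true : vertex_space two_points]) <= (mu \x mu) N)%E.
  apply: le_measure; rewrite ?inE//; first exact: measurableX.
  move=> [x y] [/= -> ->]; apply: subN => /=.
  rewrite /two_point_graphon /= => -[]/eqP.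
    by rewrite invr_eq0 pnatr_eq0.
  by rewrite invr_eq1 pnatr_eq1.
have u1 (b : vertex_space two_points) : mu [set b] = (#|two_points|%:R^-1)%:E.
  exact: uniform_prob1.
have -> : (mu \x mu)%E ([set false : vertex_space two_points] `*`
    [set true : vertex_space two_points]) = (mu [set false] * mu [set true])%E.
  exact: product_measure1E.
rewrite N0 !u1 -EFinM lee_fin leNgt.
by rewrite mulr_gt0// invr_gt0 ltr0n card_bool.
Qed.

End two_point.

Lemma random_free_not_shatters (R : realType) (P : sgraph -> Prop) :
  graph_property P -> hereditary P -> random_free R P ->
  exists k, forall G, P G -> ~ shatters G k.
Proof.
move=> P_iso P_hered P_rf; apply: contrapT => nsh.
have shk k : exists2 G, P G & shatters G k.
  apply: contrapT => h; apply: nsh; exists k => G PG Gk.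
  by apply: h; exists G.
have Pk k : exists c, P (incidence_graph c k).
  have [K HK] := @two_sided_in_shattering P _ (ord0, [ffun=> true])
    (@blowup_rel k) P_iso P_hered.
  by have [G PG GK] := shk K; exact: HK GK.
(* By pigeonhole one of the four functions [c] serves arbitrarily large [k]. *)
have [c Pc] : exists c, forall n, exists k, (n <= k)%N /\ P (incidence_graph c k).
  apply: contrapT => nc.
  have bad (c : bool -> bool) : exists n, forall k, (n <= k)%N -> ~ P (incidence_graph c k).
    apply: contrapT => nb; apply: nc; exists c => n; apply: contrapT => nk.
    by apply: nb; exists n => k nk' Pk'; apply: nk; exists k.
  (* Encoding [c] by a pair of booleans allows a maximum over a finite type. *)
  pose cc (x : bool * bool) b := if b then x.1 else x.2.
  have /choice[N HN] : forall x, exists n,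
      forall k, (n <= k)%N -> ~ P (incidence_graph (cc x) k).
    by move=> x; exact: bad.
  have [c Pck] := Pk (\max_x N x)%N.
  have cE : c = cc (c true, c false) by apply/funext => -[].
  by apply: (HN (c true, c false) (\max_x N x)%N); rewrite -?cE// leq_bigmax.
have /choice[k kP] := Pc.
apply: (@two_point_not_01 R c); apply: P_rf; split; first exact: two_point_graphonP.
exists (fun n => incidence_graph c (k n)); first by move=> n; case: (kP n).
by apply: incidence_graph_converges => n; case: (kP n).
Qed.

(** * Samples of a limit graphon *)

Section pattern_graph.
Variables (V : finType) (V0 : (0 < #|V|)%N) (A : seq (V * V)).

Definition pattern_edge : rel V :=
  fun u v => (u != v) && (((u, v) \in A) || ((v, u) \in A)).

Lemma pattern_edge_sym : symmetric pattern_edge.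
Proof. by move=> u v; rewrite /pattern_edge eq_sym orbC. Qed.

Lemma pattern_edge_irrefl : irreflexive pattern_edge.
Proof. by move=> u; rewrite /pattern_edge eqxx. Qed.

Definition pattern_graph : sgraph :=
  SGraph pattern_edge_sym pattern_edge_irrefl V0.

Lemma ordered_edges_pattern :
  all (fun p => enum_rank p.1 < enum_rank p.2)%N A ->
  ordered_edges pattern_graph = [set p in A]%SET.
Proof.
move=> /allP Ao; apply/setP => -[u v]; rewrite !inE /=.
rewrite /pattern_edge.
apply/idP/idP => [/andP[/andP[_ /orP[//|/Ao/= vu]] uv]|uvA].
  by have := ltn_trans uv vu; rewrite ltnn.
have /= uv := Ao _ uvA; rewrite uv uvA /= !andbT.
by apply/eqP => uE; move: uv; rewrite uE ltnn.
Qed.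

End pattern_graph.

Section pattern_density.
Context {R : realType} {d : measure_display} {J : measurableType d}.
Variables (mu : probability J R) (U : J * J -> R).
Hypotheses (mU : measurable_fun setT U) (U0 : forall p, 0 <= U p)
  (U1 : forall p, U p <= 1).
Variables (V : finType) (V0 : (0 < #|V|)%N).
Implicit Types A B : seq (V * V).

(** The probability, given the positions [x], that the [U]-random graph has every pair of [A] as an
    edge and every pair of [B] as a non-edge. *)
Definition pattern_weight A B (x : #|V|.-tuple J) : R :=
  (\prod_(p <- A) U (tnth x (enum_rank p.1), tnth x (enum_rank p.2))) *
  \prod_(p <- B) (1 - U (tnth x (enum_rank p.1), tnth x (enum_rank p.2))).

Definition pattern_density A B : R :=
  \int[tuple_measure mu #|V|]_x pattern_weight A B x.

Lemma pattern_weight_ge0 A B x : 0 <= pattern_weight A B x.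
Proof. by rewrite mulr_ge0// prodr_ge0// => p _; rewrite subr_ge0. Qed.

Lemma pattern_weight_le1 A B x : pattern_weight A B x <= 1.
Proof.
rewrite mulr_ile1 ?prodr_ge0//; try by move=> p _; rewrite subr_ge0.
  by apply: Num.Theory.prodr_ile1 => p _; rewrite U0 U1.
by apply: Num.Theory.prodr_ile1 => p _; rewrite subr_ge0 U1 lerBlDr lerDl U0.
Qed.

Lemma measurable_pattern_weight A B : measurable_fun setT (pattern_weight A B).
Proof.
have mp (p : V * V) : measurable_fun setT (fun x : #|V|.-tuple J =>
    U (tnth x (enum_rank p.1), tnth x (enum_rank p.2))).
  apply: measurableT_comp => //.
  by apply: measurable_fun_pair; exact: measurable_tnth.
apply: measurable_funM; apply: measurable_prod => p _ //.
exact: measurable_funB.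
Qed.

Lemma integrable_pattern_weight A B :
  (tuple_measure mu #|V|).-integrable setT (EFin \o pattern_weight A B).
Proof.
apply: integrable01; first exact: measurable_pattern_weight.
  exact: pattern_weight_ge0.
exact: pattern_weight_le1.
Qed.

Lemma pattern_density_cons A e B :
  pattern_density A (e :: B) = pattern_density A B - pattern_density (e :: A) B.
Proof.
rewrite -RintegralB//; try exact: integrable_pattern_weight.
by apply: eq_Rintegral => x _; rewrite /pattern_weight !big_cons; ring.
Qed.

Lemma pattern_density_hom A : uniq A ->
  all (fun p => enum_rank p.1 < enum_rank p.2)%N A ->
  pattern_density A [::] = hom_density mu U (pattern_graph V0 A).
Proof.
move=> uA oA; rewrite hom_densityE; apply: eq_Rintegral => x _.
rewrite /pattern_weight big_nil mulr1 ordered_edges_pattern// big_uniq//.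
by apply: eq_bigl => p; rewrite inE.
Qed.

Lemma pattern_density_eq0 A B : pattern_density A B = 0 ->
  {ae tuple_measure mu #|V|, forall x, pattern_weight A B x = 0}.
Proof.
move=> D0.
have : (\int[tuple_measure mu #|V|]_x `|(pattern_weight A B x)%:E| = 0)%E.
  under eq_integral do rewrite gee0_abs ?lee_fin ?pattern_weight_ge0//.
  rewrite -[LHS]fineK; first by rewrite -/(Rintegral _ _ _) -/(pattern_density A B) D0.
  exact: (integrable_fin_num _ (integrable_pattern_weight A B)).
move/ae_eq_integral_abs => /(_ measurableT) [].
  by apply/measurable_EFinP; exact: measurable_pattern_weight.
move=> N [mN N0 sub]; exists N; split => // x /= nx.
by apply: sub => /= /(_ I)[].
Qed.

End pattern_density.

(** Inclusion-exclusion: expanding the factors [1 - W] of [B] one at a time reduces the claim to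
    homomorphism densities. *)
Lemma pattern_density_cvg {R : realType} {d : measure_display}
    {J : measurableType d} (mu : probability J R) (W : J * J -> R)
    (G : nat -> sgraph) (V : finType) (V0 : (0 < #|V|)%N) (A B : seq (V * V)) :
  is_graphon W -> converges_to G mu W -> uniq (A ++ B) ->
  all (fun p => enum_rank p.1 < enum_rank p.2)%N (A ++ B) ->
  pattern_density (Defs.uniform_prob R (G n)) (@graph_graphon R (G n)) A B
    @[n --> \oo] --> pattern_density mu W A B.
Proof.
move=> [_ _ mW W0 W1] [_ GW]; elim: B A => [|e B IH] A.
  rewrite cats0 => uA oA; rewrite (pattern_density_hom _ _ V0)//.
  apply: cvg_trans (GW (pattern_graph V0 A)); apply: near_eq_cvg; near=> n.
  by rewrite (pattern_density_hom _ _ V0).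
move=> uA oA; rewrite pattern_density_cons//.
have E n : pattern_density (Defs.uniform_prob R (G n))
      (@graph_graphon R (G n)) A (e :: B) =
    pattern_density (Defs.uniform_prob R (G n)) (@graph_graphon R (G n)) A B -
    pattern_density (Defs.uniform_prob R (G n)) (@graph_graphon R (G n)) (e :: A) B.
  apply: pattern_density_cons.
  - by move=> _ Y _; rewrite setTI; exact: measurable_vertex_pair.
  - by move=> p; rewrite ler0n.
  - by move=> p; rewrite lern1 leq_b1.
under eq_cvg do rewrite E.
apply: cvgB; apply: IH.
- by apply: subseq_uniq uA; apply: cat_subseq (subseq_refl A) (subseq_cons B e).
- by move: oA; rewrite !all_cat /= => /and3P[-> _ ->].
- by have := perm_uniq (permEl (perm_catCA [:: e] A B)); rewrite uA.
- by move: oA; rewrite !all_cat /= => /and3P[-> -> ->].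
Unshelve. all: by end_near. Qed.

(* Almost every sample of W, wherever it takes values in {0, 1}, is the
   adjacency pattern of vertices of one of the graphs converging to W: a
   pattern met in none of them has density 0 in the limit. *)
Lemma sample_realized {R : realType} {d : measure_display}
    {J : measurableType d} (mu : probability J R) (W : J * J -> R)
    (G : nat -> sgraph) (n : nat) : (0 < n)%N ->
  is_graphon W -> converges_to G mu W ->
  {ae tuple_measure mu n, forall t, exists m (f : 'I_n -> G m),
    forall i j : 'I_n, (i < j)%N ->
      (W (tnth t i, tnth t j) = 1 -> edge (f i) (f j)) /\
      (W (tnth t i, tnth t j) = 0 -> ~~ edge (f i) (f j))}.
Proof.
move=> n0 gW GW; have [_ _ mW W0 W1] := gW.
have V0 : (0 < #|'I_n|)%N by rewrite card_ord.
(* Densities index tuples by [#|V|], so [n] is replaced by [#|'I_n|]. *)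
suff : {ae tuple_measure mu #|'I_n|, forall t, exists m (f : 'I_#|'I_n| -> G m),
    forall i j : 'I_#|'I_n|, (i < j)%N ->
      (W (tnth t i, tnth t j) = 1 -> edge (f i) (f j)) /\
      (W (tnth t i, tnth t j) = 0 -> ~~ edge (f i) (f j))}.
  by rewrite card_ord.
pose V := 'I_n; pose wd := fun p : V * V => (enum_rank p.1 < enum_rank p.2)%N.
(* Prescriptions of edges and non-edges met in no [G m]. There are finitely many, so almost every
   [t] has weight 0 for all of them at once. *)
pose bad (SS : {set V * V} * {set V * V}) :=
  uniq (enum SS.1 ++ enum SS.2) /\ all wd (enum SS.1 ++ enum SS.2) /\
  forall m (f : 'I_#|V| -> G m), ~ (
    (forall p, p \in SS.1 -> edge (f (enum_rank p.1)) (f (enum_rank p.2))) /\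
    (forall p, p \in SS.2 -> ~~ edge (f (enum_rank p.1)) (f (enum_rank p.2)))).
have aebad SS : {ae tuple_measure mu #|V|, forall t, bad SS ->
    pattern_weight W (enum SS.1) (enum SS.2) t = 0}.
  have [[uS [wS nS]]|nbad] := pselect (bad SS); last by apply: aeW => t /nbad.
  have D0 : pattern_density mu W (enum SS.1) (enum SS.2) = 0.
    have := pattern_density_cvg V0 gW GW uS wS.
    suff E m : pattern_density (Defs.uniform_prob R (G m)) (@graph_graphon R (G m))
        (enum SS.1) (enum SS.2) = 0.
      under eq_cvg do rewrite E.
      by move=> /(cvg_lim (@Rhausdorff R)) <-; rewrite lim_cst.
    rewrite /pattern_density (@eq_Rintegral _ _ _ _ _ (cst 0)).
      by rewrite /Rintegral integral0.
    move=> t _; apply/eqP; apply: contrapT => /negP ne.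
    apply: (nS m (tnth t)); move: ne; rewrite mulf_eq0 negb_or !prodf_seq_neq0.
    move=> /andP[/allP h1 /allP h2]; split=> p pS.
      have := h1 p; rewrite mem_enum pS /graph_graphon /= => /(_ isT).
      by case: edge => //; rewrite eqxx.
    have := h2 p; rewrite mem_enum pS /graph_graphon /= => /(_ isT).
    by case: edge => //; rewrite subrr eqxx.
  apply: filterS (pattern_density_eq0 mW W0 W1 D0) => t t0 _.
  exact: t0.
have : {ae tuple_measure mu #|V|, forall t, forall SS, bad SS ->
    pattern_weight W (enum SS.1) (enum SS.2) t = 0}.
  by apply: filter_forall.
apply: filterS => t ht.
pose S1 := [set p : V * V | wd p &&
  (W (tnth t (enum_rank p.1), tnth t (enum_rank p.2)) == 1)]%SET.
pose S0 := [set p : V * V | wd p &&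
  (W (tnth t (enum_rank p.1), tnth t (enum_rank p.2)) == 0)]%SET.
apply: contrapT => nreal.
(* An unrealized pattern of [t] would be bad, yet its weight at [t] is 1. *)
have /ht : bad (S1, S0).
  split; last split.
  - rewrite /= cat_uniq !enum_uniq andbT /=; apply/hasPn => p.
    rewrite !mem_enum !inE => /andP[_ /eqP ->].
    by rewrite eq_sym oner_eq0 andbF.
  - rewrite /= all_cat; apply/andP; split; apply/allP => p;
      by rewrite mem_enum inE => /andP[].
  move=> m f [h1 h0]; apply: nreal; exists m, f => i j ij.
  split=> wE.
    have := h1 (enum_val i, enum_val j); rewrite inE /wd /= !enum_valK ij wE eqxx.
    exact.
  have := h0 (enum_val i, enum_val j); rewrite inE /wd /= !enum_valK ij wE eqxx.
  exact.
rewrite /pattern_weight /= !big1_seq ?mulr1; first exact/eqP/oner_neq0.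
- by move=> p /=; rewrite mem_enum inE => /andP[_ /eqP ->]; rewrite subr0.
- by move=> p /=; rewrite mem_enum inE => /andP[_ /eqP ->].
Qed.

(** * Choosing random points one after the other *)

Lemma ae_prod (R : realType) (d1 d2 : measure_display) (T1 : measurableType d1)
    (T2 : measurableType d2) (mu : probability T1 R) (nu : probability T2 R)
    (Q : T1 * T2 -> Prop) :
  {ae (mu \x nu)%E, forall p, Q p} ->
  {ae mu, forall x, {ae nu, forall y, Q (x, y)}}.
Proof.
move=> [N [mN N0 sN]].
have : (\int[mu]_x `|nu (xsection N x)| = 0)%E.
  by under eq_integral do rewrite gee0_abs//; exact: N0.
move/ae_eq_integral_abs => /(_ measurableT) [].
  exact: measurable_fun_xsection.
move=> M [mM M0 sM]; exists M; split => // x /= nx.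
apply: sM => /= /(_ I) Nx0; apply: nx; exists (xsection N x); split => //.
  exact: measurable_xsection.
by move=> y /= nQ; rewrite /xsection /= inE; apply: sN.
Qed.

Section sequential_choice.
Context {R : realType} {d : measure_display} {J : measurableType d}.
Variable mu : probability J R.

(** Nested almost-everywhere quantifiers let each point be chosen in view of the earlier ones. *)
Fixpoint ae_iter (n : nat) (Q : seq J -> Prop) : Prop :=
  match n with
  | 0 => Q [::]
  | n'.+1 => {ae mu, forall x, ae_iter n' (fun s => Q (x :: s))}
  end.

Lemma ae_tuple_iter (n : nat) (Q : seq J -> Prop) :
  {ae tuple_measure mu n, forall t, Q (tval t)} -> ae_iter n Q.
Proof.
elim: n Q => [|n IH] Q /=.
  move=> [N [mN N0 sN]]; apply: contrapT => nQ; move: N0 => /=.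
  rewrite diracE mem_set; last exact: sN.
  by move/eqP; rewrite eqe oner_eq0.
move=> [N [mN N0 sN]].
have mp : measurable (@cons_pair _ J n @^-1` N).
  by rewrite -[X in measurable X]setTI; exact: measurable_cons_pair.
have : {ae (mu \x tuple_measure mu n)%E, forall p, Q (p.1 :: tval p.2)}.
  exists (@cons_pair _ J n @^-1` N); split => //.
  by move=> p /= nQ; apply: sN.
by move/ae_prod; apply: filterS => x; exact: IH.
Qed.

Lemma ae_iter_add (m n : nat) (Q : seq J -> Prop) :
  ae_iter (m + n) Q -> ae_iter m (fun s => ae_iter n (fun s' => Q (s ++ s'))).
Proof.
elim: m Q => [//|m IH] Q /=; apply: filterS => x /IH.
exact.
Qed.

(** A non-negligible set of good next points meets the conull set of points that keep [Q] reachable.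
    Negligibility also makes sense for sets not known to be measurable. *)
Lemma ae_iter_choose (n : nat) (Q good : seq J -> Prop) :
  ae_iter n Q -> good [::] ->
  (forall s, (size s < n)%N -> good s ->
    ~ mu.-negligible [set y | good (rcons s y)]) ->
  exists s, [/\ size s = n, good s & Q s].
Proof.
elim: n Q good => [|n IH] Q good /=; first by move=> Q0 g0 _; exists [::].
move=> aQ g0 step.
have [x gx Qx] : exists2 x, good [:: x] & ae_iter n (fun s => Q (x :: s)).
  apply: contrapT => nx; apply: (step [::]) => //.
  apply: negligibleS aQ => x /= gx nQx.
  by apply: nx; exists x.
have [|s [sn gs Qs]] := IH (fun s => Q (x :: s)) (fun s => good (x :: s)) Qx gx.
  by move=> s sn gs; exact: (step (x :: s)).
by exists (x :: s); rewrite /= sn.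
Qed.

End sequential_choice.

(** * Sampling rows near given points and columns separating them *)

Section sampling.
Context {R : realType} {d : measure_display} {J : measurableType d}.
Variables (mu : probability J R) (W : J * J -> R).
Hypotheses (gW : is_graphon W) (pW : is_pure mu W).
Let r := nbhd_dist mu W.
Let mW : measurable_fun setT W := graphon_measurable gW.

Let W01 p : 0 <= W p <= 1.
Proof. by rewrite (graphon_ge0 gW) (graphon_le1 gW). Qed.

Let msec x : measurable_fun setT (fun z => W (x, z)).
Proof. exact: measurableT_comp (pair1_measurable x). Qed.

Let mdiff x y : measurable_fun setT (fun z => `|W (x, z) - W (y, z)|).
Proof. by apply: measurableT_comp => //; exact: measurable_funB. Qed.

Let diff1 x y z : `|W (x, z) - W (y, z)| <= 1.
Proof.
have := W01 (x, z); have := W01 (y, z); rewrite ler_norml.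
by move=> /andP[? ?] /andP[? ?]; apply/andP; split; lra.
Qed.

Let nbhd_distE x y : (r x y)%:E = (\int[mu]_z `|W (x, z) - W (y, z)|%:E)%E.
Proof.
rewrite /r /nbhd_dist /Rintegral fineK//.
by apply: integrable_fin_num => //; exact: integrable01.
Qed.

(** By Tonelli, the distance from [x] is measurable as an integral of a jointly measurable
    function. *)
Lemma measurable_nbhd_ball x e : measurable [set y | r x y < e].
Proof.
have mf : measurable_fun setT (fun p : J * J => `|W (x, p.2) - W (p.1, p.2)|%:E).
  apply/measurable_EFinP; apply: measurableT_comp => //.
  apply: measurable_funB; first exact: (measurableT_comp (msec x)).
  rewrite (_ : (fun _ => _) = W)//; last by apply/funext => -[].
have := @measurable_fun_fubini_tonelli_F _ _ _ _ _ mu _ mf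
  (fun _ => ltac:(by rewrite lee_fin)).
move=> /(_ measurableT `]-oo, e%:E[%classic (emeasurable_itv _)).
rewrite setTI; congr (measurable _); apply/seteqP; split=> y /=;
  by rewrite in_itv /= /fubini_F /= -nbhd_distE lte_fin.
Qed.

Lemma nbhd_ball_not_negligible x e (C : J -> Prop) : 0 < e ->
  {ae mu, forall y, C y} -> ~ mu.-negligible [set y | r x y < e /\ C y].
Proof.
move=> e0 aeC neg.
have : mu.-negligible [set y | r x y < e].
  apply: negligibleS (negligibleU neg aeC) => y /= ry.
  by have [Cy|nCy] := pselect (C y); [left|right].
move=> /(measure_negligible (measurable_nbhd_ball x e)) mu0.
have := pure_full_support (i := pW) (U := [set y | r x y < e]).
rewrite [X in (0 < X)%E](mu0) ltxx => /(_ _ _)/notF; apply.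
  rewrite openE => y /= xy; apply/nbhs_ballP; exists (e - r x y).
    by rewrite /= subr_gt0.
  rewrite ballEmdist => z /=; rewrite -[mdist y z]/(r y z) ltrBrDl.
  exact/le_lt_trans/(is_metric_triangle (pure_metric pW)).
exists x => /=; rewrite [r x x](is_metric_xx (pure_metric pW)) //.
Qed.

(** The given points may lie in exceptional null sets; random points close to them can be taken
    outside. *)
Lemma sample_near (xs : seq J) (x0 : J) (e : R) (C : J -> Prop) (Q : seq J -> Prop) :
  0 < e -> {ae mu, forall y, C y} -> ae_iter mu (size xs) Q ->
  exists s, [/\ size s = size xs, Q s &
    forall i, (i < size xs)%N -> r (nth x0 xs i) (nth x0 s i) < e /\ C (nth x0 s i)].
Proof.
move=> e0 aeC aQ.
pose good s := forall i, (i < size s)%N ->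
  r (nth x0 xs i) (nth x0 s i) < e /\ C (nth x0 s i).
have [|s _ gs|s [sn gs Qs]] := ae_iter_choose (good := good) aQ.
- by [].
- move=> neg; apply: (@nbhd_ball_not_negligible (nth x0 xs (size s)) e C) => //.
  apply: negligibleS neg => y /= ry i; rewrite size_rcons ltnS leq_eqVlt nth_rcons.
  by case: ltngtP => [/gs//|//|->].
by exists s; split => // i; rewrite -sn; exact: gs.
Qed.

Section separation.
Variables (N : nat) (x : 'I_N -> J) (e : R).
Hypotheses (e01 : 0 < e <= 1)
  (x01 : forall i, {ae mu, forall z, W (x i, z) = 0 \/ W (x i, z) = 1})
  (xsep : forall i j, i != j -> 2 * e <= r (x i) (x j)).

Let unsep (s : seq J) : {set 'I_N * 'I_N} :=
  [set p : 'I_N * 'I_N | (p.1 != p.2) &&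
    all (fun z => W (x p.1, z) == W (x p.2, z)) s]%SET.

Let unsep_rcons s y : unsep (rcons s y) =
  [set p in unsep s | W (x p.1, y) == W (x p.2, y)]%SET.
Proof.
by apply/setP => p; rewrite !inE all_rcons -andbA [X in _ && X]andbC.
Qed.

(* Averaging: a random z separates each pair with probability at least 2e. *)
Let separating_point (s : seq J) :
  ~ mu.-negligible [set y | (forall i, W (x i, y) = 0 \/ W (x i, y) = 1) /\
      #|unsep (rcons s y)|%:R <= (1 - e) * #|unsep s|%:R].
Proof.
case/andP: e01 => e0 e1 neg.
have ae01 : {ae mu, forall z, forall i, W (x i, z) = 0 \/ W (x i, z) = 1}.
  exact: filter_forall.
(* On 0/1 values [f z] counts the pairs of [unsep s] separated by [z]. If good points were
   negligible, [f] would almost everywhere be below [e * #|unsep s|], half of the lower bound for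
   its mean. *)
pose f z : R := \sum_(p in unsep s) `|W (x p.1, z) - W (x p.2, z)|.
have aef : {ae mu, forall z, f z < e * #|unsep s|%:R}.
  apply: negligibleS (negligibleU neg ae01) => y /= nf.
  have [y01|] := pselect (forall i, W (x i, y) = 0 \/ W (x i, y) = 1); last by right.
  left; split => //; move/negP: nf; rewrite -leNgt => nf.
  have : f y + #|unsep (rcons s y)|%:R = #|unsep s|%:R.
    rewrite unsep_rcons /f -!sum1_card !natr_sum.
    rewrite [in RHS](bigID (fun p : 'I_N * 'I_N =>
      W (x p.1, y) == W (x p.2, y))) /= addrC.
    congr (_ + _); last by apply: eq_bigl => p; rewrite !inE.
    rewrite [in RHS]big_mkcondr /=; apply: eq_bigr => p _.
    case: eqVneq => [->|]; first by rewrite subrr normr0.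
    case: (y01 p.1) => ->; case: (y01 p.2) => ->; rewrite ?eqxx// => _.
      by rewrite sub0r normrN normr1.
    by rewrite subr0 normr1.
  by move=> H; rewrite mulrBl mul1r lerBrDr -H addrC lerD2r H.
have intf : (\int[mu]_z (f z)%:E = \sum_(p in unsep s) (r (x p.1) (x p.2))%:E)%E.
  under eq_bigr do rewrite nbhd_distE.
  rewrite -integral_sum//; last first.
    by move=> p; apply: integrable01 => // z; exact: diff1.
  by apply: eq_integral => z _; rewrite /f sumEFin.
have f0 z : 0 <= f z by apply: sumr_ge0.
have mf : measurable_fun setT f.
  by rewrite /f; under eq_fun do rewrite -big_enum; exact: measurable_sum.
have U0 : 0 <= e * #|unsep s|%:R by rewrite mulr_ge0// ltW.
have le1 : (\int[mu]_z (f z)%:E <= (e * #|unsep s|%:R)%:E)%E.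
  rewrite -[leRHS]mule1 -(probability_setT mu) -integral_cst//.
  apply: ae_ge0_le_integral => //.
  - by move=> z _; rewrite lee_fin.
  - exact/measurable_EFinP.
  - by apply: filterS aef => z /ltW fz _; rewrite lee_fin.
have le2 : ((2 * e * #|unsep s|%:R)%:E <= \int[mu]_z (f z)%:E)%E.
  rewrite intf sumEFin lee_fin mulr_natr -sumr_const; apply: ler_sum => p.
  by rewrite inE => /andP[pp _]; exact: xsep.
(* The two bounds leave only an empty [unsep s], and then the strict bound [aef] would make [f]
   negative. *)
have eU : e * #|unsep s|%:R <= 0.
  by have := le_trans le2 le1; rewrite lee_fin; lra.
have : mu.-negligible [set: J].
  by apply: negligibleS aef => z _ /= fz; have := f0 z; lra.
move/(measure_negligible measurableT) => h.
by have /eqP := etrans (esym h) (probability_setT mu); rewrite eqe eq_sym oner_eq0.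
Qed.

(** At most [N ^ 2] pairs are unseparated at the start, and each new point multiplies the bound by
    [1 - e]; a count below 1 is 0. *)
Lemma sample_separating (m : nat) (Q : seq J -> Prop) :
  N%:R ^+ 2 * (1 - e) ^+ m < 1 -> ae_iter mu m Q ->
  exists s, [/\ size s = m, Q s,
    forall i z, z \in s -> W (x i, z) = 0 \/ W (x i, z) = 1 &
    forall i j, i != j -> exists2 z, z \in s & W (x i, z) != W (x j, z)].
Proof.
case/andP: e01 => e0 e1 Nm aQ.
pose good s := (forall i z, z \in s -> W (x i, z) = 0 \/ W (x i, z) = 1) /\
  #|unsep s|%:R <= N%:R ^+ 2 * (1 - e) ^+ size s.
have [|s sm [g1 g2]|s [sm [g1 g2] Qs]] := ae_iter_choose (good := good) aQ.
- split=> //; rewrite expr0 mulr1 -natrX ler_nat.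
  by apply: leq_trans (max_card _) _; rewrite card_prod card_ord.
- move=> neg; apply: (separating_point (s := s)).
  apply: negligibleS neg => y /= [y01 yU]; split.
    by move=> i z; rewrite mem_rcons inE => /orP[/eqP ->|/g1].
  rewrite size_rcons (exprS (1 - e)) mulrCA; apply: le_trans yU _.
  by rewrite ler_wpM2l// subr_ge0.
exists s; split => // i j ij.
have : #|unsep s| = 0%N.
  apply/eqP; rewrite -leqn0 -ltnS -(ltr_nat R); apply: le_lt_trans g2 _.
  by rewrite sm.
move/eqP; rewrite cards_eq0 => /eqP/setP/(_ (i, j)); rewrite !inE /= ij /=.
by move/negbT/allPn => [z zs nz]; exists z.
Qed.

End separation.
End sampling.

Lemma separated_family_bound (R : realType) (d : measure_display)
    (J : measurableType d) (mu : probability J R) (W : J * J -> R)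
    (G : nat -> sgraph) (k m N : nat) (x : 'I_N -> J) (e : R) :
  is_graphon W -> is_pure mu W -> converges_to G mu W ->
  {ae (mu \x mu)%E, forall p, W p = 0 \/ W p = 1} ->
  (forall n, ~ shatters (G n) k) ->
  0 < e <= 1 -> (forall i j, i != j -> e <= nbhd_dist mu W (x i) (x j)) ->
  N%:R ^+ 2 * (1 - e / 4) ^+ m < 1 -> (N <= m.+1 ^ k)%N.
Proof.
move=> gW pW GW W01 Gk /andP[e0 e1] xsep Nm.
case: N x xsep Nm => // N x xsep Nm; rewrite leqNgt; apply/negP => kN.
pose x0 := x ord0; pose n := (N.+1 + m)%N.
(* Lists and a map on all naturals allow the sample to be cut into rows and columns; only indices
   below [n] are constrained. *)
pose Q (s : seq J) := exists M (f : nat -> G M), forall i j : nat, (i < j < n)%N ->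
  (W (nth x0 s i, nth x0 s j) = 1 -> edge (f i) (f j)) /\
  (W (nth x0 s i, nth x0 s j) = 0 -> ~~ edge (f i) (f j)).
have aQ : {ae tuple_measure mu n, forall t, Q (tval t)}.
  have := sample_realized (n := n) isT gW GW; apply: filterS => t [M [f fP]].
  exists M, (fun i => f (insubd (ord0 : 'I_n) i)) => i j /andP[ij jn].
  have lt_in := ltn_trans ij jn.
  have := fP (insubd (ord0 : 'I_n) i) (insubd (ord0 : 'I_n) j).
  by rewrite !val_insubd lt_in jn ij !(tnth_nth x0) !val_insubd lt_in jn; exact.
pose C y := {ae mu, forall z, W (y, z) = 0 \/ W (y, z) = 1}.
have aC : {ae mu, forall y, C y} := ae_prod W01.
(* Moving both points of a pair by less than [e / 4] keeps them at distance at least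
   [e / 2 = 2 * (e / 4)], the separation needed for the columns. *)
have e4 : 0 < e / 4 by rewrite divr_gt0.
have := ae_iter_add (ae_tuple_iter aQ).
pose xs := [seq x i | i <- enum 'I_N.+1].
have sxs : size xs = N.+1 by rewrite size_map size_enum_ord.
have nxs (i : 'I_N.+1) : nth x0 xs i = x i.
  by rewrite (nth_map ord0) ?size_enum_ord// nth_ord_enum.
rewrite -sxs => /(sample_near gW pW x0 e4 aC)[s [ss aQ' sP]].
rewrite sxs in ss sP.
pose x' (i : 'I_N.+1) := nth x0 s i.
have mt := pure_metric pW.
have e41 : 0 < e / 4 <= 1 by apply/andP; split; lra.
have x'sep i j : i != j -> 2 * (e / 4) <= nbhd_dist mu W (x' i) (x' j).
  move=> /xsep eij.
  have [] := sP i (ltn_ord i); have [] := sP j (ltn_ord j); rewrite !nxs => hj _ hi _.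
  have t1 := is_metric_triangle mt (x' i) (x i) (x j).
  have t2 := is_metric_triangle mt (x' j) (x' i) (x j).
  rewrite (is_metric_sym mt (x' j) (x j)) in t2.
  rewrite -/(x' i) -/(x' j) in hi hj *.
  lra.
have x'01 i : C (x' i) by have [] := sP i (ltn_ord i).
have [s' [s'm [M [f fP]] s'01 s'sep]] := sample_separating gW e41 x'01 x'sep Nm aQ'.
pose z := [seq f (N.+1 + j)%N | j <- iota 0 m].
have [||t [tk tz tsh]] := @sauer_shelah 'I_N.+1 (G M)
  (fun i y => edge (f i) y) k z [set: 'I_N.+1]%SET.
(* A point separating two rows gives a column vertex adjacent to exactly one of the two row
   vertices. *)
- move=> i j _ _ /= eij; apply: contrapT => /eqP ij.
  have [y ys' /eqP Wy] := s'sep _ _ ij; apply: Wy.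
  have ym : (index y s' < m)%N by rewrite -s'm index_mem.
  have Ek (l : 'I_N.+1) :
      (W (x' l, y) = 1 -> edge (f l) (f (N.+1 + index y s')%N)) /\
      (W (x' l, y) = 0 -> ~~ edge (f l) (f (N.+1 + index y s')%N)).
    have := fP l (N.+1 + index y s')%N.
    have nlt : (N.+1 + index y s' < N.+1)%N = false.
      by apply/negbTE; rewrite -leqNgt leq_addr.
    rewrite !nth_cat ss ltn_ord nlt addKn nth_index//; apply.
    by rewrite ltn_addr//= /n ltn_add2l.
  have Eij : edge (f i) (f (N.+1 + index y s')%N) =
      edge (f j) (f (N.+1 + index y s')%N).
    move: eij; rewrite /z -!map_comp => /eq_in_map/(_ (index y s')); apply.
    by rewrite mem_iota.
  have [i1 i0] := Ek i; have [j1 j0] := Ek j.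
  have [Wi|Wi] := s'01 i y ys'; have [Wj|Wj] := s'01 j y ys'; rewrite Wi Wj //.
    by have := i0 Wi; rewrite Eij (j1 Wj).
  by have := j0 Wj; rewrite -Eij (i1 Wi).
- by rewrite cardsT card_ord size_map size_iota.
apply: (Gk M); exists t => // tau /tsh[i _ iE].
by exists (f i); rewrite ?inE.
Qed.

(** * Packing numbers *)

(** Concavity: the tangent at [a], with its constant -1 dropped. *)
Lemma ln_le_line (R : realType) (a y : R) : 0 < a -> 0 < y -> ln y <= y / a + ln a.
Proof.
move=> a0 y0; have ya : 0 < y / a by rewrite divr_gt0.
have -> : ln y = ln (y / a) + ln a by rewrite ln_div ?posrE// subrK.
rewrite lerD2r; have -> : y / a = 1 + (y / a - 1) by ring.
by apply: le_trans (le_ln1Dx _) _; lra.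
Qed.

(** With [m] of order [L / e], the hypothesis bounds [L] by [k] times a logarithm of [L / e]; a
    tangent of small slope absorbs [L] on the right. *)
Lemma ln_card_bound (R : realType) (k N : nat) (e : R) :
  0 < e <= 1 -> (0 < N)%N ->
  (forall m, N%:R ^+ 2 * (1 - e / 4) ^+ m < 1 -> (N <= m.+1 ^ k)%N) ->
  ln N%:R <= 1 / 4 + 2 * k%:R * ln (16 * k.+1%:R) + 2 * k%:R * ln e^-1.
Proof.
move=> /andP[e0 e1] N0 H; set L := ln N%:R.
have NR : 0 < N%:R :> R by rewrite ltr0n.
have L0 : 0 <= L by rewrite ln_ge0// ler1n.
(* The first integer above [8 * L / e], which makes [2 * L - e / 4 * m] negative. *)
pose m := (Num.trunc (8 * L / e)).+1.
have /truncn_itv/andP[m1 m2] : 0 <= 8 * L / e by rewrite !mulr_ge0// invr_ge0 ltW.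
have mL : 8 * L < m%:R * e by rewrite -ltr_pdivrMr.
have : (N <= m.+1 ^ k)%N.
  apply: H; apply: (@le_lt_trans _ _ (expR (2 * L - e / 4 * m%:R))).
    have -> : N%:R ^+ 2 = expR (2 * L) :> R by rewrite expRM_natl lnK.
    rewrite expRD ler_pM2l ?expR_gt0// -[in leRHS]mulNr expRM_natr.
    by apply: lerXn2r; rewrite ?nnegrE ?expR_ge0//; [lra|exact: expR_ge1Dx].
  by rewrite -[ltRHS]expR0 ltr_expR; lra.
have Y0 : 0 < (8 * L + 2) / e by rewrite divr_gt0//; lra.
rewrite -(ler_nat R) natrX => Nk.
have mY : m.+1%:R <= (8 * L + 2) / e.
  rewrite mulrDl -[m.+1]/(_.+2) -addn2 natrD lerD// ler_pdivlMr//.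
  by rewrite -[leRHS]mulr1 ler_wpM2l.
have h : L <= k%:R * ln ((8 * L + 2) / e).
  rewrite mulr_natl -lnXn// ler_ln ?posrE ?exprn_gt0//.
  apply: le_trans Nk _; apply: lerXn2r; rewrite ?nnegrE ?ler0n//; exact: ltW.
have a0 : 0 < 16 * k.+1%:R :> R by rewrite mulr_gt0// ltr0n.
have l2 : ln ((8 * L + 2) / e) <=
    (8 * L + 2) / (16 * k.+1%:R) + ln (16 * k.+1%:R) + ln e^-1.
  by rewrite lnM ?posrE ?invr_gt0//; [rewrite lerD2r; apply: ln_le_line => //; lra|lra].
(* The tangent point [16 * k.+1] leaves at most [L / 2] on the right; moving it to the left doubles
   the other terms. *)
have l3 : k%:R * ((8 * L + 2) / (16 * k.+1%:R)) <= L / 2 + 1 / 8.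
  rewrite mulrA ler_pdivrMr// -(natr1 k).
  have k0 : 0 <= k%:R :> R by rewrite ler0n.
  have := mulr_ge0 L0 k0; lra.
have : k%:R * ln ((8 * L + 2) / e) <=
    k%:R * ((8 * L + 2) / (16 * k.+1%:R) + ln (16 * k.+1%:R) + ln e^-1).
  by rewrite ler_wpM2l.
move: h l3; set v := ln (_ / e); set u := (8 * L + 2) / _; set w := ln (16 * _).
by rewrite !mulrDr; lra.
Qed.

Section metric.
Context {R : realType} (M : metricType R).

(** A separated family of maximal size is a net, since a point outside its balls could be added. *)
Lemma totally_bounded_cover (e : R) (n : nat) :
  (forall s : seq M, pairwise (fun x y => e <= mdist x y) s -> (size s <= n)%N) ->
  exists s : seq M, forall y, exists2 x, x \in s & ball x e y.
Proof.
move=> sn.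
pose good m := `[< exists2 s : seq M,
  pairwise (fun x y => e <= mdist x y) s & size s = m >].
have ex : exists m, good m by exists 0%N; apply/asboolP; exists [::].
have ub m : good m -> (m <= n)%N by move=> /asboolP[s ps <-]; exact: sn.
case: (ex_maxnP ex ub) => m /asboolP[s ps sm] mmax.
exists s => y; apply: contrapT => ny.
suff : good m.+1 by move/mmax; rewrite ltnn.
apply/asboolP; exists (y :: s); last by rewrite /= sm.
rewrite /= ps andbT; apply/allP => x xs; rewrite leNgt; apply/negP => yx.
by apply: ny; exists x => //; rewrite ballEmdist /= metric_sym.
Qed.

(** An ultrafilter contains one ball of each finite cover, so it is Cauchy and converges. *)
Lemma complete_totally_bounded_compact :
  complete_space M ->
  (forall e : R, 0 < e ->
    exists s : seq M, forall y, exists2 x, x \in s & ball x e y) ->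
  compact [set: M].
Proof.
move=> cM tb; rewrite compact_ultra => F UF _.
have [|x Fx] := cM F _; last by exists x.
apply: cauchy_exP => e /tb[s sP]; apply: contrapT => nball.
have nF x : F (~` ball x e).
  by have [|//] := in_ultra_setVsetC (ball x e) UF => Fx; case: nball; exists x.
have : F [set y | forall x, x \in s -> ~ ball x e y].
  elim: s {sP} => [|x s IH]; first exact: filterE.
  apply: filterS2 (nF x) IH => y yx ys x'.
  by rewrite inE => /orP[/eqP ->|/ys].
move=> FH; apply: (@filter_not_empty _ F); apply: filterS FH => y Hy.
by have [x xs xy] := sP y; apply: (Hy x).
Qed.

(** The point [x0] makes packing numbers at least 1, so the quotient is nonnegative; below
    [expR (-1)] the denominator is at least 1, so the quotient is at most [C + D]. *)
Lemma packing_dim_fin_num (x0 : M) (C D : R) :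
  0 <= C -> 0 <= D ->
  (forall (e : R) (s : seq M), 0 < e <= 1 -> (0 < size s)%N ->
     pairwise (fun x y => e <= mdist x y) s -> ln (size s)%:R <= C + D * ln e^-1) ->
  packing_dim M \is a fin_num.
Proof.
move=> C0 D0 bnd.
pose f (e : R) := (lne (packing_number M e) / (ln e^-1)%:E)%E.
have pn1 e : (1 <= packing_number M e)%E.
  by apply: le_ereal_sup_tmp; exists 1%E => //=; exists [:: x0].
have pnB (e : R) : 0 < e <= 1 -> (packing_number M e <= (expR (C + D * ln e^-1))%:E)%E.
  move=> e01; apply: ge_ereal_sup => _ [s ps <-]; rewrite lee_fin.
  case: (posnP (size s)) => [->|s0]; first exact: expR_ge0.
  rewrite -[leLHS]lnK ?posrE ?ltr0n// ler_expR; exact: bnd.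
have lninv (e : R) : 0 < e < expR (-1) -> 1 <= ln e^-1.
  move=> /andP[e0 e1]; rewrite lnV ?posrE// lerNr -[leRHS]expRK.
  rewrite ler_ln ?posrE ?expR_gt0//.
  exact: ltW.
have e1 (e : R) : 0 < e < expR (-1) -> 0 < e <= 1.
  move=> /andP[-> e1] /=; apply: le_trans (ltW e1) _.
  by rewrite -[leRHS]expR0 ler_expR; lra.
have f0 (e : R) : 0 < e < expR (-1) -> (0 <= f e)%E.
  move=> he; apply: mule_ge0; first by rewrite lne_ge0.
  by rewrite inve_ge0 lee_fin; apply: le_trans (lninv _ he).
have fB (e : R) : 0 < e < expR (-1) -> (f e <= (C + D)%:E)%E.
  move=> he; have L1 := lninv _ he; have L0 : 0 < ln e^-1 by apply: lt_le_trans L1.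
  have iL : ((ln e^-1)%:E^-1 = (ln e^-1)^-1%:E)%E by rewrite inver gt_eqF.
  rewrite /f iL; apply: (@le_trans _ _ ((C + D * ln e^-1)%:E * (ln e^-1)^-1%:E)%E).
    rewrite lee_pmul2r ?lte_fin ?invr_gt0//.
    have <- : lne (expR (C + D * ln e^-1))%:E = (C + D * ln e^-1)%:E.
      by rewrite lne_EFin ?expR_gt0// expRK.
    rewrite lee_lne ?pnB ?e1// in_itv /= leey andbT.
      exact: le_trans (pn1 e).
    by rewrite lee_fin expR_ge0.
  rewrite -EFinM lee_fin ler_pdivrMr// mulrDl lerD2r.
  by rewrite -[leLHS]mulr1 ler_wpM2l.
have V0 : 0^'+ [set e : R | 0 < e < expR (-1)].
  near=> e => /=; apply/andP; split; near: e.
    exact: nbhs_right_gt.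
  by apply: nbhs_right_lt; exact: expR_gt0.
rewrite fin_numElt; apply/andP; split.
  apply: (@lt_le_trans _ _ 0%E) => //.
  apply: le_ereal_inf_tmp => _ [V FV <-].
  have [e [Ve e01]] := @filter_ex _ _ (at_right_proper_filter (0 : R)) _
    (filterI FV V0).
  by apply: le_ereal_sup_tmp; exists (f e); [exists e|exact: f0].
apply: (@le_lt_trans _ _ (C + D)%:E); last exact: ltry.
apply: ge_ereal_inf; exists (ereal_sup (f @` [set e : R | 0 < e < expR (-1)])).
  by exists [set e : R | 0 < e < expR (-1)].
by apply: ge_ereal_sup => _ [e he <-]; exact: fB.
Unshelve. all: by end_near. Qed.
End metric.

Theorem theorem4p15 (R : realType) (P : sgraph -> Prop)
    (P_iso : graph_property P) (P_hered : hereditary P)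
    (P_rf : random_free R P)
    (d : measure_display) (J : measurableType d) (mu : probability J R)
    (W : J * J -> R) (W_cl : in_closure P mu W) (W_pure : is_pure mu W) :
  compact [set: metric_space (pure_metric W_pure)] /\
  packing_dim (metric_space (pure_metric W_pure)) \is a fin_num.
Proof.
have [k Pk] := @random_free_not_shatters R P P_iso P_hered P_rf.
have W01 := P_rf _ _ _ _ W_cl.
have [gW [G PG GW]] := W_cl.
set M := metric_space (pure_metric W_pure).
pose C : R := 1 / 4 + 2 * k%:R * ln (16 * k.+1%:R).
have bnd (e : R) (s : seq M) : 0 < e <= 1 -> (0 < size s)%N ->
    pairwise (fun x y => e <= mdist x y) s ->
    ln (size s)%:R <= C + 2 * k%:R * ln e^-1.
  move=> e01 s0 ps; apply: ln_card_bound => // m.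
  have x0 : M by case: s s0 {ps}.
  apply: (@separated_family_bound _ _ _ mu W G k m _ (fun i => nth x0 s i) e) => //.
    by move=> n; exact: Pk.
  move=> i j; rewrite neq_ltn => /orP[ij|ji].
    by have /(pairwiseP x0) /(_ i j) := ps; apply; rewrite ?inE.
  rewrite (is_metric_sym (pure_metric W_pure)).
  by have /(pairwiseP x0) /(_ j i) := ps; apply; rewrite ?inE.
have C0 : 0 <= C.
  rewrite addr_ge0// !mulr_ge0// ln_ge0// -natrM ler1n.
  by rewrite muln_gt0.
split.
  apply: complete_totally_bounded_compact; first exact: pure_complete.
  (* The packing bound holds for radii at most 1, and smaller balls cover as well. *)
  move=> e e0; pose e' := Num.min e 1.
  have e'01 : 0 < e' <= 1 by rewrite lt_min e0 ltr01 ge_min lexx orbT.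
  pose n := (Num.trunc (expR (C + 2 * k%:R * ln e'^-1)))%N.
  have [|s sP] := @totally_bounded_cover _ M e' n.
    move=> s ps; have [->//|s0] := posnP (size s).
    rewrite /n truncn_ge_nat ?expR_ge0// -[leLHS]lnK ?posrE ?ltr0n// ler_expR.
    exact: bnd.
  exists s => y; have [x xs xy] := sP y; exists x => //.
  by apply: le_ball xy; rewrite ge_min lexx.
by apply: (@packing_dim_fin_num _ M (point : J) C (2 * k%:R)).
Qed.
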